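(* Let $X$ be an infinite-dimensional Banach space. Then there exists a (not necessarily semi-normalized) basic sequence $(x_i)_{i=1}^\infty$ in $X$ such that every normalized constant coefficient block basic sequence (NCCB basic sequence) of $(x_i)$ is good. Additionally, if the sequence $(x_i)$ produced is semi-normalized and also unconditional, then all of the spreading models of these good sequences are uniformly equivalent to the unit vector basis of $c_0$ or of $\ell_p$ for some $1\leq p<\infty$.
   Context: Scalars are real; bases and basic sequences are Schauder. A sequence $(x_i)$ is semi-normalized if $0<\inf_i\|x_i\|\leq\sup_i\|x_i\|<\infty$. NCCB basic sequence: for finite nonempty $E,F\subset\mathbb{N}$ write $E<F$ if $\max E<\min F$. A sequence $(y_i)_{i=1}^\infty$ is a normalized constant coefficient block basic sequence (NCCB basic sequence) of a basic sequence $(x_i)$ if there are finite nonempty sets $E_1<E_2<\cdots$ of natural numbers such that $y_i=\frac{\sum_{k\in E_i}x_k}{\|\sum_{k\in E_i}x_k\|}$ for all $i$. Good sequence: a normalized basic sequence $(y_i)$ is good if for every $n\in\mathbb{N}$ and all scalars $(a_i)_{i=1}^n$ the limit $\lim_{k_1\to\infty}\|\sum_{i=1}^n a_i y_{k_i}\|$ (over $k_1<k_2<\cdots<k_n$) exists; equivalently, $(y_i)$ generates a spreading model. Spreading model: a basic sequence is $1$-spreading if it is $1$-equivalent to all of its subsequences. A normalized $1$-spreading basis $(e_i)$ of a Banach space $(E,\|\cdot\|_s)$ is the spreading model generated by a normalized basic sequence $(y_i)$ if for all $\epsilon>0$ and $n\in\mathbb{N}$ there is $N\in\mathbb{N}$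 such that $\big|\,\|\sum_{i=1}^n a_i y_{k_i}\|-\|\sum_{i=1}^n a_i e_i\|_s\big|\leq\epsilon$ for all $(a_i)_{i=1}^n\in[-1,1]^n$ and all $N\leq k_1<\cdots<k_n$. Equivalence: for $C\geq1$, sequences $(u_i)$, $(v_i)$ are $C$-equivalent if $\frac1C\|\sum a_i v_i\|\leq\|\sum a_i u_i\|\leq C\|\sum a_i v_i\|$ for all finitely supported scalars $(a_i)$. ''Uniformly equivalent to the unit vector basis of $c_0$ or $\ell_p$'' means that there are one such space and one constant $C\geq 1$ such that all the spreading models in question are $C$-equivalent to the unit vector basis of that space. *)

(* Defs.v *)
From HB Require Import structures.
From mathcomp Require Import all_boot all_order all_algebra finmap.
From mathcomp Require Import all_classical all_reals all_analysis.

Set Implicit Arguments.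
Unset Strict Implicit.
Unset Printing Implicit Defensive.

Import Order.TTheory GRing.Theory Num.Theory.
Import numFieldNormedType.Exports.

Local Open Scope classical_set_scope.
Local Open Scope ring_scope.

(* Sequences are indexed from 0. A finitely supported scalar sequence is given
   by a : nat -> R together with a length n; the terms a i with n <= i are
   ignored. *)

Definition infinite_dimensional (R : realType) (X : normedModType R) : Prop :=
  ~ exists (n : nat) (v : 'I_n -> X),
      forall z : X, exists a : 'I_n -> R, z = \sum_(i < n) a i *: v i.

Definition lin_comb (R : realType) (V : normedModType R)
    (x : nat -> V) (a : nat -> R) (n : nat) : V :=
  \sum_(i < n) a i *: x i.

Definition closed_span (R : realType) (V : normedModType R) (x : nat -> V) :
    set V :=
  closure [set z | exists (a : nat -> R) (n : nat), z = lin_comb x a n].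

Definition expands_uniquely (R : realType) (V : normedModType R)
    (x : nat -> V) (z : V) : Prop :=
  exists! a : nat -> R, lin_comb x a @ \oo --> z.

Definition schauder_basis (R : realType) (V : normedModType R)
    (x : nat -> V) : Prop :=
  forall z : V, expands_uniquely x z.

Definition basic_sequence (R : realType) (V : normedModType R)
    (x : nat -> V) : Prop :=
  forall z : V, closed_span x z -> expands_uniquely x z.

Definition normalized (R : realType) (V : normedModType R)
    (x : nat -> V) : Prop :=
  forall i, `|x i| = 1.

(* [has_ubound] says that the supremum of the norms is finite; the infimum is
   that of a nonempty set bounded below by 0, so [inf] is the true infimum. *)
Definition semi_normalized (R : realType) (V : normedModType R)
    (x : nat -> V) : Prop :=
  0 < inf (range (fun i => `|x i|)) /\ has_ubound (range (fun i => `|x i|)).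

Definition unconditional (R : realType) (V : normedModType R)
    (x : nat -> V) : Prop :=
  exists K : R, forall (n : nat) (a : nat -> R) (s : nat -> bool),
    `|lin_comb x (fun i => (-1) ^+ s i * a i) n| <= K * `|lin_comb x a n|.

Definition fset_before (E F : {fset nat}) : Prop :=
  forall i j : nat, i \in E -> j \in F -> (i < j)%N.

Definition nccb (R : realType) (V : normedModType R) (x y : nat -> V) : Prop :=
  exists E : nat -> {fset nat},
    [/\ forall i, E i != fset0,
        forall i, fset_before (E i) (E i.+1) &
        forall i, y i = `|\sum_(k <- E i) x k|^-1 *: \sum_(k <- E i) x k].

Definition strictly_increasing (k : nat -> nat) : Prop :=
  forall i j : nat, (i < j)%N -> (k i < k j)%N.

(* Tuples k_1 < ... < k_n of naturals are given as the first n terms of a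
   strictly increasing sequence. *)
Definition good (R : realType) (V : normedModType R) (y : nat -> V) : Prop :=
  [/\ normalized y, basic_sequence y &
      forall (n : nat) (a : nat -> R), exists l : R,
        forall eps : R, 0 < eps -> exists N : nat,
          forall k : nat -> nat, strictly_increasing k -> (N <= k 0%N)%N ->
            `| `|lin_comb (y \o k) a n| - l | <= eps].

(* [coef_norm R] is the type of norms on finitely supported scalar sequences.
   Equivalence of two sequences only involves the norms they induce there; the
   unit vector bases of c_0 and l_p are represented by [c0_norm] and
   [lp_norm p]. *)
Definition coef_norm (R : realType) := (nat -> R) -> nat -> R.

Definition norm_of (R : realType) (V : normedModType R) (u : nat -> V) :
    coef_norm R :=
  fun a n => `|lin_comb u a n|.

Definition c0_norm (R : realType) : coef_norm R :=
  fun a n => \big[Num.max/0]_(i < n) `|a i|.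

Definition lp_norm (R : realType) (p : R) : coef_norm R :=
  fun a n => (\sum_(i < n) `|a i| `^ p) `^ p^-1.

Definition equivalent (R : realType) (C : R) (f g : coef_norm R) : Prop :=
  forall (a : nat -> R) (n : nat), C^-1 * g a n <= f a n <= C * g a n.

Definition one_spreading (R : realType) (V : normedModType R)
    (e : nat -> V) : Prop :=
  forall k : nat -> nat, strictly_increasing k ->
    equivalent 1 (norm_of e) (norm_of (e \o k)).

Definition spreading_model (R : realType) (V : normedModType R)
    (y : nat -> V) (S : completeNormedModType R) (e : nat -> S) : Prop :=
  [/\ schauder_basis e, normalized e, one_spreading e &
      forall (eps : R) (n : nat), 0 < eps -> exists N : nat,
        forall (a : nat -> R) (k : nat -> nat),
          (forall i, (i < n)%N -> -1 <= a i <= 1) ->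
          strictly_increasing k -> (N <= k 0%N)%N ->
          `| `|lin_comb (y \o k) a n| - `|lin_comb e a n| | <= eps].

Definition nccb_spreading_models_equivalent (R : realType)
    (V : normedModType R) (x : nat -> V) (C : R) (g : coef_norm R) : Prop :=
  forall (y : nat -> V), nccb x y ->
  forall (S : completeNormedModType R) (e : nat -> S), spreading_model y e ->
    equivalent C (norm_of e) g.

(* Main.v *)
Require Import Defs.
From HB Require Import structures.
From mathcomp Require Import all_boot all_order all_algebra finmap.
From mathcomp Require Import all_classical all_reals all_analysis.
From mathcomp Require Import ring lra.

Set Implicit Arguments.
Unset Strict Implicit.
Unset Printing Implicit Defensive.

Import Order.TTheory GRing.Theory Num.Theory.
Import numFieldNormedType.Exports.

Local Open Scope classical_set_scope.
Local Open Scope ring_scope.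

(** Existence. By Mazur's construction [X] contains a normalized basic sequence,
    and by the theorem of Brunel and Sucheston a subsequence [z] of it is such
    that the norms of the combinations of [z k_1, ..., z k_n] have limits as
    [k_1 < ... < k_n] tend to infinity. The sequence [x k = k! *: z k] then does
    the job: since [\sum_(k < m) k!] is at most [2 * m! / m], a sum of vectors
    [x k] over a finite set with largest element [m] is, after normalization,
    within [4 / m] of [z m]. So every NCCB sequence of [x] is asymptotic to a
    subsequence of [z] and has the same limits; and it is basic because block
    sequences inherit the basis constant ([grunblum_block_sum]). Both classical
    theorems are obtained from a nonprincipal ultrafilter. For Mazur's, one needs
    unit vectors [u] with [(1 - d) * |f| <= |f + c *: u|] for all [f] in a given
    finite dimensional subspace; normalized differences of a separated sequence
    have this property ([ultra_difference]), and a finite net of coefficients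
    makes it uniform ([mazur_step]). For Brunel and Sucheston's, iterated limits
    along the ultrafilter provide the limits, and a subsequence is chosen that
    realizes them for all rational coefficients.

    Uniqueness. Two NCCB sequences of [x] can be interleaved, so when all of them
    are good they have the same limits [F a n], and the convergence is uniform
    over all block sequences far out ([uniform_limit]). The norm of every
    spreading model is therefore [F]. Put [lam n = F (1, ..., 1)], with [n]
    coefficients. Computing the norm of a sum of [\sum_j N j] vectors, grouped
    into blocks of lengths [N j] or not, gives
    [F (lam (N 0), ..., lam (N (m - 1))) = lam (\sum_j N j)]
    ([fundamental_sum]). In particular [lam] is multiplicative, and it is
    monotone up to the unconditional constant [K], so [lam n = n ^ al] with
    [0 <= al <= 1] ([multiplicative_power_law]). If [al = 0] then [F] is bounded
    on vectors of ones, and unconditionality makes it equivalent to the norm of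
    c_0. Otherwise, with [p = al ^-1], approximating [T * |a j| ^ p] by integers
    [N j] turns the displayed identity into the equivalence of [F] with the norm
    of l_p. *)

(** * Linear combinations and Grunblum's criterion *)

Section Reals.
Variable R : realType.

Lemma exists_natSinv_le (e : R) : 0 < e ->
  exists n, forall k, (n <= k)%N -> k.+1%:R^-1 <= e.
Proof.
move=> e0; exists (Num.truncn e^-1) => k nk.
rewrite invf_ple ?posrE//; apply/ltW/(lt_le_trans (truncnS_gt _)).
by rewrite ler_nat ltnS.
Qed.

Lemma cvgn_cauchy (u : nat -> R) :
  (forall e, 0 < e -> exists n, forall k, (n <= k)%N -> `|u k - u n| < e) ->
  cvgn u.
Proof.
move=> uC; apply/cauchy_cvgP/cauchy_exP => e e0.
have [n hn] := uC e e0; exists (u n); exists n => // k /= nk.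
by rewrite -ball_normE /= distrC hn.
Qed.

End Reals.

Section LinComb.
Variables (R : realType) (V : normedModType R).
Implicit Types (x : nat -> V) (a b : nat -> R).

Lemma lin_comb0 x a : lin_comb x a 0 = 0.
Proof. by rewrite /lin_comb big_ord0. Qed.

Lemma lin_combS x a n : lin_comb x a n.+1 = lin_comb x a n + a n *: x n.
Proof. by rewrite /lin_comb big_ord_recr. Qed.

Lemma lin_combD x a b n :
  lin_comb x (fun i => a i + b i) n = lin_comb x a n + lin_comb x b n.
Proof.
by rewrite /lin_comb -big_split; apply: eq_bigr => i _; rewrite scalerDl.
Qed.

Lemma lin_combZ x a c n : lin_comb x (fun i => c * a i) n = c *: lin_comb x a n.
Proof.
by rewrite /lin_comb scaler_sumr; apply: eq_bigr => i _; rewrite scalerA.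
Qed.

Lemma lin_combB x a b n :
  lin_comb x (fun i => a i - b i) n = lin_comb x a n - lin_comb x b n.
Proof.
by rewrite /lin_comb -sumrB; apply: eq_bigr => i _; rewrite scalerBl.
Qed.

Lemma eq_lin_comb x y a b n :
  (forall i, (i < n)%N -> a i *: x i = b i *: y i) ->
  lin_comb x a n = lin_comb y b n.
Proof. by move=> ab; apply: eq_bigr => i _; exact: ab. Qed.

Lemma lin_comb_widen x a m n : (m <= n)%N ->
  (forall i, (m <= i)%N -> a i = 0) -> lin_comb x a n = lin_comb x a m.
Proof.
move=> mn a0; rewrite -(subnKC mn); elim: (n - m)%N => [|k IH].
  by rewrite addn0.
by rewrite addnS lin_combS IH a0 ?leq_addr// scale0r addr0.
Qed.

Lemma lin_comb_trunc x a n : lin_comb x (fun i => if (i < n)%N then a i else 0) n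
  = lin_comb x a n.
Proof. by apply: eq_lin_comb => i ->. Qed.

Lemma norm_lin_comb_le x a n :
  `|lin_comb x a n| <= \sum_(i < n) `|a i| * `|x i|.
Proof.
rewrite /lin_comb (le_trans (ler_norm_sum _ _ _))//.
by apply: ler_sum => i _; rewrite normrZ.
Qed.

(** Grunblum's condition with constant [K]: the initial segment projections
    of the span are uniformly bounded. *)
Definition grunblum (K : R) x := forall a m n, (m <= n)%N ->
  `|lin_comb x a m| <= K * `|lin_comb x a n|.

Lemma grunblum_coef K x a i n : 0 <= K -> grunblum K x -> (i < n)%N ->
  `|a i| * `|x i| <= 2 * K * `|lin_comb x a n|.
Proof.
move=> K0 gK iltn; rewrite -normrZ.
have -> : a i *: x i = lin_comb x a i.+1 - lin_comb x a i.
  by rewrite lin_combS addrAC subrr add0r.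
rewrite (le_trans (ler_normB _ _))// -mulrA mulrDl mul1r.
by rewrite lerD// gK// ltnW.
Qed.

Lemma cvg_lin_comb x (b : nat -> nat -> R) be m :
  (forall i, (i < m)%N -> b l i @[l --> \oo] --> be i) ->
  lin_comb x (b l) m @[l --> \oo] --> lin_comb x be m.
Proof.
move=> bbe; elim: m bbe => [_|m IH bbe].
  under eq_fun do rewrite lin_comb0.
  by rewrite lin_comb0; exact: cvg_cst.
under eq_fun do rewrite lin_combS.
rewrite lin_combS; apply: cvgD.
  by apply: IH => i im; exact: bbe (ltnW im).
by apply: cvgZr_tmp; exact: bbe.
Qed.

(** Grunblum's criterion. Completeness is not needed, since only points of the
    closed span are expanded. *)
Lemma grunblum_basic K x : (forall i, x i != 0) -> grunblum K x ->
  basic_sequence x.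
Proof.
move=> x0 gK.
have K0 : 0 <= K.
  rewrite -(@pmulr_lge0 _ `|lin_comb x (fun=> 1) 1|).
    by rewrite (le_trans _ (gK (fun=> 1) 1%N 1%N _)).
  by rewrite lin_combS lin_comb0 add0r scale1r normr_gt0.
move=> z zx.
(* Approximants [w k] of [z], with coefficients that vanish from [N k] on. *)
have /choice[u hu] (k : nat) : exists u : (nat -> R) * nat,
    (forall i, (u.2 <= i)%N -> u.1 i = 0) /\
    `|z - lin_comb x u.1 u.2| < k.+1%:R^-1.
  have kgt0 : 0 < k.+1%:R^-1 :> R by [].
  have [_ [[a [n ->]] /=]] := zx _ (nbhsx_ballx z _ kgt0).
  rewrite -ball_normE /= => zk.
  exists (fun i => if (i < n)%N then a i else 0, n); split => /=.
    by move=> i; rewrite leqNgt => /negbTE ->.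
  by rewrite lin_comb_trunc.
pose a k := (u k).1; pose N k := (u k).2.
have a0 k i : (N k <= i)%N -> a k i = 0 by exact: (hu k).1.
have aN k n : (N k <= n)%N -> lin_comb x (a k) n = lin_comb x (a k) (N k).
  by move=> Nn; apply: lin_comb_widen => // i; exact: a0.
pose w k := lin_comb x (a k) (N k).
have wz k : `|z - w k| < k.+1%:R^-1 by exact: (hu k).2.
have segB k l m : `|lin_comb x (a k) m - lin_comb x (a l) m| <= K * `|w k - w l|.
  rewrite -lin_combB.
  pose M := (m + (N k + N l))%N.
  rewrite (le_trans (gK _ m M _)) ?leq_addr// ler_wpM2l// lin_combB !aN//.
    by rewrite /M addnA leq_addl.
  by rewrite /M addnCA leq_addr.
have wB k l : `|w k - w l| <= k.+1%:R^-1 + l.+1%:R^-1.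
  by rewrite (le_trans (ler_distD z _ _))// distrC lerD// ltW.
have cvg_a i : cvgn (fun k => a k i).
  apply: cvgn_cauchy => e e0.
  have xi0 : 0 < `|x i| by rewrite normr_gt0.
  have e'0 : 0 < e * `|x i| / (2 * (2 * K + 1)).
    by rewrite divr_gt0 ?mulr_gt0//; lra.
  have [n hn] := exists_natSinv_le e'0; exists n => k nk.
  rewrite -(ltr_pM2r xi0).
  have hc : `|a k i - a n i| * `|x i| <= 2 * K * `|w k - w n|.
    pose M := (i.+1 + (N k + N n))%N.
    have iM : (i < M)%N by rewrite ltn_addr.
    rewrite (le_trans (grunblum_coef (fun i => a k i - a n i) K0 gK iM))//.
    rewrite lin_combB !aN//; first by rewrite /M addnA leq_addl.
    by rewrite /M addnCA leq_addr.
  have wkn : `|w k - w n| <= 2 * (e * `|x i| / (2 * (2 * K + 1))).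
    by apply: (le_trans (wB _ _)); rewrite mulr_natl mulr2n lerD// hn.
  apply: (le_lt_trans (le_trans hc (ler_wpM2l _ wkn))); first by rewrite mulr_ge0.
  rewrite (_ : 2 * K * _ = (2 * K / (2 * K + 1)) * (e * `|x i|)); last first.
    by field; lra.
  by rewrite gtr_pMl ?mulr_gt0// ltr_pdivrMr ?mul1r; lra.
pose al i := limn (fun k => a k i).
have segal k m : `|lin_comb x (a k) m - lin_comb x al m| <= K * (k.+1%:R^-1).
  have c1 : (fun l => `|lin_comb x (a k) m - lin_comb x (a l) m|) @ \oo -->
      `|lin_comb x (a k) m - lin_comb x al m|.
    apply: cvg_norm; apply: cvgB; first exact: cvg_cst.
    by apply: cvg_lin_comb => i _; exact: cvg_a.
  have c2 : (fun l => K * (k.+1%:R^-1 + l.+1%:R^-1)) @ \oo -->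
      K * (k.+1%:R^-1 + 0 : R).
    apply: cvgM; first exact: cvg_cst.
    by apply: cvgD; [exact: cvg_cst|exact: cvg_harmonic].
  rewrite -[k.+1%:R^-1]addr0; apply: (ler_cvg_to c1 c2).
  by apply: nearW => l; rewrite (le_trans (segB _ _ _))// ler_wpM2l.
have al_z : lin_comb x al @ \oo --> z.
  apply/cvgrPdist_le => e e0.
  have K1 : 0 < K + 1 by lra.
  have [k hk] := exists_natSinv_le (divr_gt0 e0 K1).
  have {}hk : (K + 1) * k.+1%:R^-1 <= e by rewrite mulrC -ler_pdivlMr ?hk//; lra.
  exists (N k) => // m /= Nm.
  rewrite (_ : z - _ = (z - w k) + (lin_comb x (a k) m - lin_comb x al m)).
    rewrite (le_trans (ler_normD _ _))// (le_trans _ hk)// mulrDl addrC mul1r.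
    by rewrite lerD// ltW.
  by rewrite /w -(aN _ _ Nm) addrA subrK.
exists al; split => // b bz.
have d0 : lin_comb x (fun i => al i - b i) @ \oo --> (0 : V).
  have -> : lin_comb x (fun i => al i - b i) = lin_comb x al \- lin_comb x b.
    by apply/funext => m; exact: lin_combB.
  by rewrite -(subrr z); exact: cvgB.
have seg0 m : lin_comb x (fun i => al i - b i) m = 0.
  apply/eqP; rewrite -normr_le0.
  have c1 : (fun n => K * `|lin_comb x (fun i => al i - b i) n|) @ \oo -->
      K * `|0 : V|.
    by apply: cvgM; [exact: cvg_cst|exact: cvg_norm].
  rewrite normr0 mulr0 in c1.
  apply: (ler_cvg_to (cvg_cst _) c1).
  by near=> n; apply: gK; near: n; exact: nbhs_infty_ge.
apply/funext => i; apply/eqP; rewrite -subr_eq0.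
have := lin_combS x (fun i => al i - b i) i.
rewrite !seg0 add0r => /esym/eqP.
by rewrite scaler_eq0 (negbTE (x0 i)) orbF.
Unshelve. all: by end_near. Qed.
End LinComb.

(** * Separated sequences and finite nets *)

(** Choice of a sequence whose terms may depend on all the preceding ones. *)
Lemma history_choice (T : Type) (P : seq T -> T -> Prop) :
  (forall s, exists t, P s t) -> exists w : nat -> T, forall k, P (mkseq w k) (w k).
Proof.
move=> /choice[g gP].
pose h k := iter k (fun s => rcons s (g s)) [::].
exists (fun k => g (h k)) => k.
suff -> : mkseq (fun k => g (h k)) k = h k by exact: gP.
by elim: k => // k IH; rewrite mkseqS IH.
Qed.

Lemma nonprincipal_ultrafilter : exists U : set_system nat,
  UltraFilter U /\ forall n, U [set k | (n <= k)%N].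
Proof.
have [U [UU sub]] := ultraFilterLemma (F := \oo) _.
by exists U; split=> // n; apply: sub; exact: nbhs_infty_ge.
Qed.

Lemma filter_all_seq (T : Type) (I : eqType) (F : set_system T) (P : I -> set T)
    (L : seq I) : Filter F -> (forall i, i \in L -> F (P i)) ->
  F [set t | forall i, i \in L -> P i t].
Proof.
move=> FF; elim: L => [_|i L IH FP]; first by apply: filterS filterT.
have Fi : F (P i) by apply: FP; rewrite mem_head.
have FL : F [set t | forall i, i \in L -> P i t].
  by apply: IH => j jL; apply: FP; rewrite inE jL orbT.
apply: filterS (filterI Fi FL) => t [Pi PL] j.
by rewrite inE => /predU1P[->|/PL].
Qed.

Section Separated.
Variables (R : realType) (X : normedModType R).

(** In an infinite dimensional normed space, finitely many balls of radius
    [2^-1] do not cover the unit ball: otherwise every point of the unit ball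
    would be of the form [\sum_m 2 ^- m *: c_m] with centres [c_m], hence in the
    span of the centres. *)
Lemma unit_ball_not_covered (hX : infinite_dimensional X) (n : nat)
    (c : nat -> X) :
  exists x, `|x| <= 1 /\ forall i, (i < n)%N -> 2^-1 < `|x - c i|.
Proof.
apply: contrapT => ncov; apply: hX.
(* [f x] is the index of a centre close to [x]. *)
have /choice[f fP] (x : X) : exists i, `|x| <= 1 ->
    (i < n)%N /\ `|x - c i| <= 2^-1.
  have [x1|x1] := leP `|x| 1; last by exists 0%N.
  apply: contrapT => nx; apply: ncov; exists x; split=> // i ilt.
  by rewrite ltNge; apply/negP => xi; apply: nx; exists i.
suff span1 x : `|x| <= 1 -> exists a, x = lin_comb c a n.
  exists n, (fun i => c i) => z.
  have z1 : 0 < `|z| + 1 by rewrite ltr_wpDl.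
  have [|a za] := span1 ((`|z| + 1)^-1 *: z).
    rewrite normrZ ger0_norm ?invr_ge0 ?(ltW z1)// ler_pdivrMl// mulr1.
    by rewrite lerDl.
  exists (fun i => (`|z| + 1) * a i).
  rewrite -[RHS]/(lin_comb c (fun i => (`|z| + 1) * a i) n) lin_combZ -za.
  by rewrite scalerA divff ?gt_eqF// scale1r.
move=> x1.
(* [r] maps the unit ball to itself and [x = c (f x) + 2^-1 *: r x]; iterating
   this identity gives the expansion [xE], in which [T i m] collects the
   coefficients of [c i]. *)
pose r v := 2 *: (v - c (f v)).
pose v m := iter m r x.
have v1 m : `|v m| <= 1.
  elim: m => // m IH; rewrite /v iterS -/(v m) /r normrZ ger0_norm//.
  by rewrite mulrC -ler_pdivlMr// div1r (fP _ IH).2.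
pose T i m : R := \sum_(k < m) 2^-1 ^+ k * (f (v k) == i)%:R.
have TS i m : T i m.+1 = T i m + 2^-1 ^+ m * (f (v m) == i)%:R.
  by rewrite /T big_ord_recr.
have xE m : x = lin_comb c (fun i => T i m) n + 2^-1 ^+ m *: v m.
  elim: m => [|m IH].
    rewrite expr0 scale1r /lin_comb big1 ?add0r// => i _.
    by rewrite /T big_ord0 scale0r.
  have -> : lin_comb c (fun i => T i m.+1) n =
      lin_comb c (fun i => T i m) n + 2^-1 ^+ m *: c (f (v m)).
    rewrite -[X in _ + X](_ : lin_comb c
        (fun i => 2^-1 ^+ m * (f (v m) == i)%:R) n = _).
      rewrite -lin_combD; apply: eq_lin_comb => i _.
      by rewrite TS.
    rewrite lin_combZ; congr (_ *: _).
    have fn := (fP _ (v1 m)).1.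
    rewrite /lin_comb (bigD1 (Ordinal fn))//= eqxx scale1r big1 ?addr0//.
    move=> i /eqP ni; case: eqP => [fi|]; last by rewrite scale0r.
    by case: ni; apply/val_inj.
  rewrite {1}IH -addrA; congr (_ + _).
  rewrite /v iterS -/(v m) /r scalerA exprSr -mulrA mulVf// mulr1.
  by rewrite -scalerDr addrC subrK.
have T2 i m : 0 <= T i m <= 2 - 2 * 2^-1 ^+ m.
  elim: m => [|m /andP[h1 h2]]; first by rewrite /T big_ord0 expr0 mulr1 subrr lexx.
  rewrite TS exprS mulrA divff// mul1r.
  have p0 : 0 <= 2^-1 ^+ m :> R by rewrite exprn_ge0.
  by case: eqP => _; rewrite ?mulr1 ?mulr0; apply/andP; split; lra.
have Tcvg i : cvgn (T i).
  apply: nondecreasing_is_cvgn.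
    apply/nondecreasing_seqP => m; rewrite TS lerDl mulr_ge0// exprn_ge0//.
  exists 2 => _ [m _ <-]; have /andP[_ h] := T2 i m.
  have p0 : 0 <= 2^-1 ^+ m :> R by rewrite exprn_ge0.
  lra.
exists (fun i => limn (T i)).
have c1 : (fun m => lin_comb c (fun i => T i m) n + 2^-1 ^+ m *: v m) @ \oo -->
    lin_comb c (fun i => limn (T i)) n + 0.
  apply: cvgD.
    by apply: (@cvg_lin_comb _ _ c (fun m i => T i m)) => i _; exact: Tcvg.
  have p0 : (2^-1 ^+ m : R) @[m --> \oo] --> 0.
    by apply: cvg_expr; rewrite ger0_norm// invf_lt1// ltr1n.
  apply/cvgr0Pnorm_le => e e0.
  move/cvgr0Pnorm_le: p0 => /(_ e e0); apply: filterS => m.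
  rewrite normrZ => h; rewrite (le_trans _ h)// ler_piMr//.
have c2 : (fun m => lin_comb c (fun i => T i m) n + 2^-1 ^+ m *: v m) = cst x.
  by apply/funext => m; rewrite -xE.
rewrite c2 addr0 in c1.
exact: (cvg_unique _ (cvg_cst x) c1).
Qed.

Lemma separated_sequence (hX : infinite_dimensional X) :
  exists w : nat -> X, (forall k, `|w k| <= 1) /\
    forall i k, (i < k)%N -> 2^-1 < `|w k - w i|.
Proof.
have [s|w wP] := @history_choice X (fun s x => `|x| <= 1 /\
    forall i, (i < size s)%N -> 2^-1 < `|x - nth 0 s i|).
  exact: unit_ball_not_covered.
exists w; split=> [k|i k ik]; first by have [] := wP k.
have [_ /(_ i)] := wP k; rewrite size_mkseq => /(_ ik).
by rewrite nth_mkseq.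
Qed.

End Separated.

Section Nets.
Variables (R : realType) (X : normedModType R).

Lemma interval_net (B d : R) : 0 < d ->
  exists T : seq R, forall t, `|t| <= B -> exists2 s, s \in T & `|t - s| <= d.
Proof.
move=> d0; exists (mkseq (fun k => k%:R * d - B) (Num.truncn (2 * B / d)).+1).
move=> t; rewrite ler_norml => /andP[t1 t2].
have tB : 0 <= (t + B) / d by rewrite divr_ge0 ?(ltW d0)//; lra.
exists ((Num.truncn ((t + B) / d))%:R * d - B).
  apply/mapP; exists (Num.truncn ((t + B) / d)) => //.
  rewrite mem_iota /= ltnS; apply: le_truncn.
  by rewrite ler_pM2r ?invr_gt0//; lra.
have /andP[] := truncn_itv tB; set k := Num.truncn _.
rewrite ler_pdivlMr// ltr_pdivrMr// -natr1 mulrDl mul1r => h1 h2.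
by rewrite ler_norml; apply/andP; split; lra.
Qed.

(** The combinations with coefficients in a bounded box are totally bounded;
    the points of the net need not be such combinations. *)
Lemma lin_comb_net (z : nat -> X) n (B d : R) : 0 < d ->
  exists L : seq X, forall a : nat -> R, (forall i, (i < n)%N -> `|a i| <= B) ->
    exists2 g, g \in L & `|lin_comb z a n - g| <= d.
Proof.
elim: n d => [|n IH] d d0.
  by exists [:: 0] => a _; exists 0; rewrite ?inE// lin_comb0 subrr normr0 ltW.
have d2 : 0 < d / 2 by rewrite divr_gt0.
have [L LP] := IH _ d2.
have d3 : 0 < d / 2 / (`|z n| + 1) by rewrite divr_gt0// ltr_wpDl.
have [T TP] := @interval_net B _ d3.
exists [seq g + t *: z n | g <- L, t <- T] => a aB.
have [g gL ag] := LP a (fun i im => aB i (ltnW im)).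
have [t tT at_] := TP (a n) (aB n (leqnn _)).
exists (g + t *: z n); first exact: allpairs_f.
rewrite lin_combS opprD addrACA -scalerBl (le_trans (ler_normD _ _))//.
rewrite [leRHS](splitr d) lerD// normrZ.
have z1 : 0 < `|z n| + 1 by rewrite ltr_wpDl.
rewrite (le_trans (ler_wpM2r _ at_))// mulrAC ler_pdivrMr// ler_pM2l//.
by rewrite lerDl.
Qed.

End Nets.

(** * Basic sequences in infinite dimensional spaces *)

Section Mazur.
Variables (R : realType) (X : normedModType R).

(** For a bounded sequence [w] and an ultrafilter limit, adding multiples of the
    differences [w k - w l] does not decrease the norm of [f]. If it did,
    there would be indices [k_0, k_1, ...] with
    [`|f + c *: (w k_i - w k_(i+1))| < `|f| - e]; averaging the first [n]
    of these vectors gives [f + (c / n) *: (w k_0 - w k_n)], whose norm tends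
    to [`|f|]. *)
Lemma ultra_difference (U : set_system nat) (w : nat -> X) (f : X) (c e : R) :
  UltraFilter U -> (forall k, `|w k| <= 1) -> 0 < e ->
  U [set k | U [set l | `|f| - e <= `|f + c *: (w k - w l)|]].
Proof.
move=> UU w1 e0; set A := [set k | _].
have [//|UnA] := in_ultra_setVsetC A UU.
have [k0 k0A] : (~` A) !=set0 by exact: (filter_ex UnA).
have /choice[g gP] (k : nat) : exists l, ~ A k ->
    ~ A l /\ `|f + c *: (w k - w l)| < `|f| - e.
  have [Ak|nAk] := pselect (A k); first by exists 0%N.
  have [//|UB] :=
    in_ultra_setVsetC [set l | `|f| - e <= `|f + c *: (w k - w l)|] UU.
  have [l [lA lB]] : (~` A `&` ~` [set l | `|f| - e <= `|f + c *: (w k - w l)|])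
      !=set0 by exact: (filter_ex (filterI UnA UB)).
  by exists l => _; split=> //; rewrite ltNge; apply/negP.
pose k i := iter i g k0.
have kA i : ~ A (k i) by elim: i => [|i IH]; [exact: k0A|exact: (gP _ IH).1].
have kS i : `|f + c *: (w (k i) - w (k i.+1))| < `|f| - e
  by exact: (gP _ (kA i)).2.
have tele n : \sum_(i < n) (f + c *: (w (k i) - w (k i.+1))) =
    n%:R *: f + c *: (w (k 0%N) - w (k n)).
  elim: n => [|n IH]; first by rewrite big_ord0 scale0r subrr scaler0 addr0.
  rewrite big_ord_recr /= IH -natr1 scalerDl scale1r addrACA -scalerDr.
  by rewrite addrA subrK.
have main n : n%:R * e <= 2 * `|c|.
  have h1 : `|n%:R *: f + c *: (w (k 0%N) - w (k n))| <= n%:R * (`|f| - e).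
    rewrite -tele (le_trans (ler_norm_sum _ _ _))//.
    rewrite (le_trans (ler_sum _ (fun (i : 'I_n) _ => ltW (kS i))))//.
    by rewrite sumr_const card_ord mulr_natl.
  have h2 : `|c *: (w (k 0%N) - w (k n))| <= 2 * `|c|.
    rewrite normrZ mulrC ler_wpM2r//.
    rewrite (le_trans (ler_normB _ _))// -[2]/(1 + 1) lerD//.
  have h3 : n%:R * `|f| <=
      `|n%:R *: f + c *: (w (k 0%N) - w (k n))| + `|c *: (w (k 0%N) - w (k n))|.
    rewrite -[n%:R in leLHS]normr_nat -normrZ.
    by rewrite -{1}[n%:R *: f](addrK (c *: (w (k 0%N) - w (k n)))) ler_normB.
  lra.
have := main (Num.truncn (2 * `|c| / e)).+1.
rewrite -ler_pdivlMr// leNgt => /negP; case.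
exact: truncnS_gt.
Qed.

(** One step of Mazur's construction: a vector almost orthogonal, in the sense
    of Birkhoff, to the span of finitely many given vectors. Their independence
    is expressed by a bound of the coefficients by the norm. *)
Lemma mazur_step (hX : infinite_dimensional X) (z : nat -> X) (n : nat)
    (B d : R) : 0 < d ->
  (forall a i, (i < n)%N -> `|a i| <= B * `|lin_comb z a n|) ->
  exists u : X, `|u| = 1 /\ forall a c,
    (1 - d) * `|lin_comb z a n| <= `|lin_comb z a n + c *: u|.
Proof.
move=> d0 zB.
have [w [w1 wsep]] := separated_sequence hX.
have [U [UU Uinf]] := nonprincipal_ultrafilter.
have d4 : 0 < d / 4 by rewrite divr_gt0.
have d8 : 0 < d / 8 by rewrite divr_gt0.
have [L LP] := @lin_comb_net _ X z n B _ d4.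
have [T TP] := @interval_net R 4 _ d8.
have Uall (s : seq (X * R)) : U [set k | U [set l | forall p, p \in s ->
    `|p.1| - d / 4 <= `|p.1 + p.2 *: (w k - w l)|]].
  have hU p : U [set k | U [set l |
      `|p.1| - d / 4 <= `|p.1 + p.2 *: (w k - w l)|]].
    exact: ultra_difference.
  have : U [set k | forall p, p \in s -> U [set l |
      `|p.1| - d / 4 <= `|p.1 + p.2 *: (w k - w l)|]].
    by apply: filter_all_seq => p _; exact: hU.
  by apply: filterS => k hk; exact: filter_all_seq hk.
have [k hk] := filter_ex (Uall [seq (g, t) | g <- L, t <- T]).
have [l [hl kl]] := filter_ex (filterI hk (Uinf k.+1)).
rewrite /= in hl kl.
pose v := w k - w l.
have v2 : `|v| <= 2.
  by rewrite (le_trans (ler_normB _ _))// -[2]/(1 + 1) lerD.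
have v12 : 2^-1 < `|v| by rewrite distrC wsep.
have v0 : 0 < `|v| by rewrite (lt_trans _ v12).
have hv f c : f \in L -> `|c| <= 4 -> `|f| - d / 2 <= `|f + c *: v|.
  move=> fL /TP[t tT ct].
  have := hl (f, t) (allpairs_f _ fL tT) => /= h.
  have h1 : `|f + t *: v| <= `|f + c *: v| + d / 4.
    have -> : f + t *: v = (f + c *: v) - (c - t) *: v.
      by rewrite scalerBl opprB -addrA; congr (_ + _); rewrite addrC subrK.
    rewrite (le_trans (ler_normB _ _))// lerD2l normrZ.
    rewrite (_ : d / 4 = d / 8 * 2); last by field.
    by rewrite ler_pM.
  lra.
exists (`|v|^-1 *: v); split.
  by rewrite normrZ ger0_norm ?invr_ge0 ?ltW// mulVf// gt_eqF.
suff main a c : `|lin_comb z a n| = 1 -> 1 - d <= `|lin_comb z a n + c *: v|.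
  move=> a c; have [->|f0] := eqVneq (lin_comb z a n) 0.
    by rewrite normr0 mulr0.
  have nf : 0 < `|lin_comb z a n| by rewrite normr_gt0.
  rewrite -ler_pdivlMr//.
  have := main (fun i => `|lin_comb z a n|^-1 * a i)
    (`|lin_comb z a n|^-1 * (c / `|v|)).
  rewrite lin_combZ normrZ normfV normr_id mulVf ?gt_eqF// => /(_ erefl).
  rewrite -[(_ * (c / _)) *: v]scalerA -scalerDr normrZ normfV normr_id.
  by rewrite mulrC scalerA.
move=> f1.
(* For [|c| > 4] the second term has norm at least [2]; the remaining [c] and
   the coefficients of the first term lie in the nets. *)
have aB i : (i < n)%N -> `|a i| <= B.
  by move=> /(zB a i); rewrite f1 mulr1.
have [c4|c4] := leP `|c| 4.
  have [g gL fg] := LP a aB.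
  have := hv g c gL c4 => h.
  have h1 : 1 <= `|g| + d / 4.
    by have := ler_normD (lin_comb z a n - g) g; rewrite subrK f1; lra.
  have h2 : `|g + c *: v| <= `|lin_comb z a n + c *: v| + d / 4.
    have := ler_normB (lin_comb z a n + c *: v) (lin_comb z a n - g).
    by rewrite opprB addrC addrA subrK; lra.
  lra.
have h : 2 <= `|c *: v|.
  rewrite normrZ (_ : 2 = 4 * 2^-1); last by field.
  by rewrite ler_pM// ltW.
have := ler_normB (lin_comb z a n + c *: v) (lin_comb z a n).
rewrite addrAC subrr add0r f1; lra.
Qed.

(** Mazur's theorem. Each new vector may lower the norm of the preceding segment
    by a factor [K n / K n.+1], where [K n = 2 - n.+1%:R^-1] lies between [1]
    and [2]; the products of consecutive factors are then at least [2^-1]. *)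
Theorem mazur (hX : infinite_dimensional X) :
  exists z : nat -> X, normalized z /\ grunblum 2 z.
Proof.
pose K n : R := 2 - n.+1%:R^-1.
have K1 n : 1 <= K n.
  by rewrite /K lerBrDl -lerBrDr -[2]/(1 + 1) addrK invf_le1// ler1n.
have K2 n : K n <= 2 by rewrite gerBl.
have KS n : K n < K n.+1.
  by rewrite ltrD2l ltrN2 ltf_pV2 ?posrE// ltr_nat.
have K0 n : 0 < K n by rewrite (lt_le_trans _ (K1 n)).
have d0 n : 0 < 1 - K n / K n.+1 by rewrite subr_gt0 ltr_pdivrMr// mul1r.
have [s|z zP] := @history_choice X (fun s u => `|u| = 1 /\
    ((forall a i, (i < size s)%N ->
        `|a i| <= 4 * `|lin_comb (nth 0 s) a (size s)|) ->
     forall a c, (K (size s) / K (size s).+1) *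
        `|lin_comb (nth 0 s) a (size s)| <=
        `|lin_comb (nth 0 s) a (size s) + c *: u|)).
  have [h|h] := pselect (forall a i, (i < size s)%N ->
        `|a i| <= 4 * `|lin_comb (nth 0 s) a (size s)|).
    have [u [u1 uP]] := mazur_step hX (d0 (size s)) h.
    by exists u; split=> // _ a c; rewrite (le_trans _ (uP a c))// subKr.
  have [|u [u1 _]] := @mazur_step hX (fun=> 0) 0 0 1 ltr01; first by [].
  by exists u.
have z1 : normalized z by move=> k; have [] := zP k.
have step n : (forall a i, (i < n)%N -> `|a i| <= 4 * `|lin_comb z a n|) ->
    forall a, K n * `|lin_comb z a n| <= K n.+1 * `|lin_comb z a n.+1|.
  move=> zn a; have [_] := zP n; rewrite size_mkseq.
  have E b : lin_comb (nth 0 (mkseq z n)) b n = lin_comb z b n.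
    by apply: eq_lin_comb => i im; rewrite nth_mkseq.
  move=> h; have := h _ a (a n); rewrite !E -lin_combS => /(_ _).
  have hz : forall a i, (i < n)%N ->
      `|a i| <= 4 * `|lin_comb (nth 0 (mkseq z n)) a n|.
    by move=> b i im; rewrite E; exact: zn.
  by move=> /(_ hz); rewrite mulrAC ler_pdivrMr// [leRHS]mulrC.
have seg n : forall a m, (m <= n)%N ->
    K m * `|lin_comb z a m| <= K n * `|lin_comb z a n|.
  elim: n => [|n IH] a m; first by rewrite leqn0 => /eqP ->.
  rewrite leq_eqVlt => /predU1P[->//|]; rewrite ltnS => mn.
  rewrite (le_trans (IH a m mn))//; apply: step => {mn a}a i im.
  have bd k : (k <= n)%N -> `|lin_comb z a k| <= 2 * `|lin_comb z a n|.
    move=> kn; have := IH a k kn => h.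
    rewrite (@le_trans _ _ (K k * `|lin_comb z a k|)) ?ler_peMl//.
    by rewrite (le_trans h)// ler_wpM2r.
  have -> : `|a i| = `|lin_comb z a i.+1 - lin_comb z a i|.
    by rewrite lin_combS addrAC subrr add0r normrZ z1 mulr1.
  rewrite (le_trans (ler_normB _ _))//.
  have := bd _ im; have := bd _ (ltnW im); lra.
exists z; split=> // a m n mn.
rewrite (@le_trans _ _ (K m * `|lin_comb z a m|)) ?ler_peMl//.
by rewrite (le_trans (seg n a m mn))// ler_wpM2r.
Qed.

End Mazur.

(** * Spreading limits of subsequences *)

Section BrunelSucheston.
Variables (R : realType) (X : normedModType R).
Implicit Types (z : nat -> X) (s : seq R).

Lemma ultra_bounded_cvg (U : set_system nat) (h : nat -> R) (M : R) :
  UltraFilter U -> (forall k, `|h k| <= M) -> cvg (h @ U).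
Proof.
move=> UU hM.
have UM : U [set k | h k \in `[- M, M]].
  apply: filterS filterT => k _ /=.
  by rewrite in_itv /= -ler_norml.
have [p [_ pcl]] := @segment_compact R (- M) M (h @ U) _ UM.
apply/cvg_ex; exists p; apply/cvgrPdist_lt => e e0.
have [//|Uc] := in_ultra_setVsetC [set k | `|p - h k| < e] UU.
have pe : nbhs p (ball p e) by exact: nbhsx_ballx.
have [_ [[k nk <-] hk]] := pcl (h @` (~` [set k | `|p - h k| < e])) _
  (filterS (fun k nk => ex_intro2 _ _ k nk erefl) Uc) pe.
by case: nk; rewrite -ball_normE in hk.
Qed.

(** [iter_lim U z s w] is the iterated limit along [U], first in [k_n], last in
    [k_1], of [`|w + s_1 *: z k_1 + ... + s_n *: z k_n|]. *)
Fixpoint iter_lim (U : set_system nat) z s (w : X) : R :=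
  if s is a :: s' then lim ((fun k => iter_lim U z s' (w + a *: z k)) @ U)
  else `|w|.

Lemma iter_lim_bounded U z s w : UltraFilter U -> normalized z ->
  `|iter_lim U z s w| <= `|w| + \sum_(a <- s) `|a|.
Proof.
move=> UU z1; elim: s w => [|a s IH] w /=; first by rewrite big_nil addr0 normr_id.
have bd k : `|iter_lim U z s (w + a *: z k)| <= `|w| + \sum_(a <- a :: s) `|a|.
  rewrite (le_trans (IH _))// big_cons addrA lerD2r.
  by rewrite (le_trans (ler_normD _ _))// normrZ z1 mulr1.
have hc := ultra_bounded_cvg UU bd.
apply: (ler_cvg_to (cvg_norm hc) (cvg_cst _)).
by apply: nearW => k; exact: bd.
Qed.

Lemma iter_lim_cvg U z a s w : UltraFilter U -> normalized z ->
  iter_lim U z s (w + a *: z k) @[k --> U] --> iter_lim U z (a :: s) w.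
Proof.
move=> UU z1; apply: (@ultra_bounded_cvg U _ (`|w| + `|a| + \sum_(a <- s) `|a|)).
move=> k; rewrite (le_trans (iter_lim_bounded _ _ _ _))// lerD2r.
by rewrite (le_trans (ler_normD _ _))// normrZ z1 mulr1.
Qed.

Lemma iter_lim_lipschitz U z (a b : nat -> R) n w w' :
  UltraFilter U -> normalized z ->
  `|iter_lim U z (mkseq a n) w - iter_lim U z (mkseq b n) w'| <=
  `|w - w'| + \sum_(i < n) `|a i - b i|.
Proof.
move=> UU z1; elim: n a b w w' => [|n IH] a b w w'.
  by rewrite /= big_ord0 addr0 ler_dist_dist.
have mkS (c : nat -> R) : mkseq c n.+1 = c 0%N :: mkseq (fun i => c i.+1) n.
  by rewrite /mkseq /= (iotaDl 1 0) -map_comp.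
rewrite !mkS.
have ca := @iter_lim_cvg U z (a 0%N) (mkseq (fun i => a i.+1) n) w UU z1.
have cb := @iter_lim_cvg U z (b 0%N) (mkseq (fun i => b i.+1) n) w' UU z1.
apply: (ler_cvg_to (cvg_norm (cvgB ca cb)) (cvg_cst _)).
apply: nearW => k; rewrite (le_trans (IH _ _ _ _))// big_ord_recl /= addrA.
rewrite lerD2r opprD addrACA -scalerBl (le_trans (ler_normD _ _))//.
by rewrite normrZ z1 mulr1.
Qed.

(** An enumeration of the finite sequences of rational numbers. *)
Definition rat_seq (j : nat) : seq R :=
  map ratr (odflt [::] (choice.unpickle j : option (seq rat))).

Lemma rat_seqP (q : nat -> rat) n :
  exists j, rat_seq j = mkseq (fun i => ratr (q i)) n.
Proof.
exists (choice.pickle (mkseq q n)).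
by rewrite /rat_seq choice.pickleK /= /mkseq -map_comp.
Qed.

(** The pairs [(w, s)] that constrain the choice of [kap j]: [w] is a partial
    combination of vectors [z (kap i)] with [i < j] and the coefficients of an
    enumerated sequence, whose other coefficients form [s]. *)
Fixpoint states z (kap : nat -> nat) (j : nat) : seq (X * seq R) :=
  if j is i.+1 then
    states z kap i ++
    [seq (p.1 + head 0 p.2 *: z (kap i), behead p.2) | p <- states z kap i] ++
    [:: (0, rat_seq i)]
  else [::].

Lemma eq_states z kap kap' j : (forall i, (i < j)%N -> kap i = kap' i) ->
  states z kap j = states z kap' j.
Proof.
elim: j => //= j IH E; rewrite IH; last by move=> i ij; apply: E; exact: ltnW.
by rewrite E.
Qed.

Lemma states_mono z kap i j : (i <= j)%N ->
  {subset states z kap i <= states z kap j}.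
Proof.
move=> ij; rewrite -(subnKC ij); elim: (j - i)%N => [|k IH] p.
  by rewrite addn0.
by rewrite addnS /= => /IH pk; rewrite mem_cat pk.
Qed.

Lemma states_step z kap i j w a s : (i <= j)%N ->
  (w, a :: s) \in states z kap i ->
  (w + a *: z (kap j), s) \in states z kap j.+1.
Proof.
move=> ij /(states_mono ij) h /=; rewrite !mem_cat; apply/orP; right.
apply/orP; left.
by apply/mapP; exists (w, a :: s).
Qed.

Lemma lin_comb_recl (x : nat -> X) (a : nat -> R) n :
  lin_comb x a n.+1 = a 0%N *: x 0%N + lin_comb (x \o S) (a \o S) n.
Proof. by rewrite /lin_comb big_ord_recl. Qed.

(** The last clause in the definition of a good sequence: the norms of the
    combinations of [n] terms converge as the indices tend to infinity. *)
Definition has_spreading_limits (y : nat -> X) : Prop :=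
  forall (n : nat) (a : nat -> R), exists l : R,
    forall eps : R, 0 < eps -> exists N : nat,
      forall k : nat -> nat, strictly_increasing k -> (N <= k 0%N)%N ->
        `| `|lin_comb (y \o k) a n| - l | <= eps.

(** The theorem of Brunel and Sucheston. *)
Theorem brunel_sucheston z : normalized z ->
  exists kap, strictly_increasing kap /\ has_spreading_limits (z \o kap).
Proof.
move=> z1.
have [U [UU Uinf]] := nonprincipal_ultrafilter.
pose G := iter_lim U z.
(* The choice of [kap j] replaces, in each of the finitely many states, one
   iterated limit by its value at [kap j] up to [j.+1%:R^-1]. *)
have [p|kap kapP] := @history_choice nat (fun p k =>
  (forall i, i \in p -> (i < k)%N) /\
  (forall q, q \in states z (nth 0%N p) (size p) ->
    `|G (behead q.2) (q.1 + head 0 q.2 *: z k) - G q.2 q.1| <=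
    (size p).+1%:R^-1)).
  have U1 : U [set k | forall i, i \in p -> (i < k)%N].
    by apply: filter_all_seq => i _; exact: Uinf i.+1.
  have U2 (L : seq (X * seq R)) (e : R) : 0 < e -> U [set k | forall q, q \in L ->
      `|G (behead q.2) (q.1 + head 0 q.2 *: z k) - G q.2 q.1| <= e].
    move=> e0; apply: (@filter_all_seq _ _ U (fun q => [set k |
      `|G (behead q.2) (q.1 + head 0 q.2 *: z k) - G q.2 q.1| <= e]) L).
    move=> [w [|a s]] _ /=.
      apply: filterS filterT => k _ /=.
      by rewrite scale0r addr0 subrr normr0 ltW.
    have /cvgrPdist_le/(_ _ e0) := @iter_lim_cvg U z a s w UU z1.
    by apply: filterS => k; rewrite distrC.
  have e0 : 0 < (size p).+1%:R^-1 :> R by [].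
  have [k [h1 h2]] :=
    filter_ex (filterI U1 (U2 (states z (nth 0%N p) (size p)) _ e0)).
  by exists k.
have kap_lt : strictly_increasing kap.
  move=> i j ij; have [h _] := kapP j; apply: h.
  by apply/mapP; exists i; rewrite // mem_iota.
have stepP j q : q \in states z kap j ->
    `|G (behead q.2) (q.1 + head 0 q.2 *: z (kap j)) - G q.2 q.1| <= j.+1%:R^-1.
  have [_] := kapP j; rewrite size_mkseq => h qj; apply: h.
  rewrite (@eq_states _ _ kap)// => i ij.
  by rewrite nth_mkseq.
(* Choosing the vectors of a state one by one costs at most [j.+1%:R^-1]
   each. *)
have main s w j (k : nat -> nat) : (w, s) \in states z kap j ->
    strictly_increasing k -> (j <= k 0%N)%N ->
    `| `|w + lin_comb (z \o kap \o k) (nth 0 s) (size s)| - G s w | <=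
    (size s)%:R * j.+1%:R^-1.
  elim: s w j k => [|a s IH] w j k wj kinc jk.
    by rewrite lin_comb0 addr0 /= subrr normr0 mul0r.
  rewrite /= lin_comb_recl /= addrA.
  have st := states_step jk wj.
  have kinc' : strictly_increasing (k \o S) by move=> m n mn; exact: kinc.
  have k01 : ((k 0%N).+1 <= (k \o S) 0%N)%N by exact: kinc.
  have h1 := IH _ _ _ st kinc' k01.
  have h2 := stepP _ _ (states_mono jk wj).
  have hj m : (j <= m)%N -> m.+1%:R^-1 <= j.+1%:R^-1 :> R.
    by move=> jm; rewrite lef_pV2 ?posrE// ler_nat ltnS.
  rewrite -natr1 mulrDl mul1r.
  rewrite (le_trans (ler_distD (G s (w + a *: z (kap (k 0%N)))) _ _))//.
  rewrite lerD//; last by rewrite (le_trans h2)// hj.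
  by rewrite (le_trans h1)// ler_wpM2l// hj// ltnW.
exists kap; split=> // n a.
exists (G (mkseq a n) 0) => eps eps0.
have n1 : 0 < n.+1%:R :> R by [].
have [d d0 dE] : exists2 d, 0 < d & n.+1%:R * d = eps / 3.
  exists (eps / 3 / n.+1%:R); first by rewrite !divr_gt0.
  by rewrite mulrC divfK// gt_eqF.
have /choice[q qP] (i : nat) : exists q : rat, `|a i - ratr q| <= d.
  have [|q] := @rat_in_itvoo R (a i - d) (a i + d); first by lra.
  rewrite in_itv /= => /andP[h1 h2]; exists q.
  by rewrite ler_norml; apply/andP; split; lra.
have sum_le : \sum_(i < n) `|a i - ratr (q i)| <= eps / 3.
  rewrite (le_trans (ler_sum _ (fun (i : 'I_n) _ => qP i)))//.
  rewrite -dE sumr_const card_ord -[d *+ n]mulr_natl ler_pM2r//.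
  by rewrite ler_nat.
have [j jP] := rat_seqP q n.
have [m mP] := exists_natSinv_le d0.
exists (maxn j.+1 m) => k kinc kN.
have st : (0, mkseq (fun i => ratr (q i)) n) \in states z kap (maxn j.+1 m).
  apply: (@states_mono _ _ j.+1); first by rewrite leq_maxl.
  by rewrite /= !mem_cat -jP mem_head !orbT.
have h1 := main _ _ _ _ st kinc kN.
rewrite add0r size_mkseq in h1.
have h2 : `| lin_comb (z \o kap \o k) a n -
    lin_comb (z \o kap \o k) (nth 0 (mkseq (fun i => ratr (q i)) n)) n| <= eps / 3.
  rewrite -lin_combB (le_trans (norm_lin_comb_le _ _ _))// (le_trans _ sum_le)//.
  by apply: ler_sum => i _; rewrite nth_mkseq// z1 mulr1.
have h3 := @iter_lim_lipschitz U z (fun i => ratr (q i)) a n 0 0 UU z1.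
rewrite subrr normr0 add0r in h3.
have {}h3 : `|G (mkseq (fun i => ratr (q i)) n) 0 - G (mkseq a n) 0| <= eps / 3.
  rewrite (le_trans h3)// (le_trans _ sum_le)//; apply: ler_sum => i _.
  by rewrite distrC.
have h4 : n%:R * (maxn j.+1 m).+1%:R^-1 <= eps / 3.
  by rewrite -dE ler_pM// ?ler_nat// mP// leq_maxr.
have h5 := le_trans (ler_dist_dist _ _) h2.
rewrite (le_trans (ler_distD (`|lin_comb (z \o kap \o k)
  (nth 0 (mkseq (fun i => ratr (q i)) n)) n|) _ _))//.
have h6 := le_trans (ler_distD (G (mkseq (fun i => ratr (q i)) n) 0) _ _)
  (lerD (le_trans h1 h4) h3).
apply: (le_trans (lerD h5 h6)); lra.
Qed.

End BrunelSucheston.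

(** * Block sequences and the existence of x *)

(** Successive finite nonempty sets of indices. *)
Definition blocks (E : nat -> {fset nat}) : Prop :=
  (forall i, E i != fset0) /\ (forall i, fset_before (E i) (E i.+1)).

Lemma strictly_increasing_ge k : strictly_increasing k -> forall i, (i <= k i)%N.
Proof.
move=> kinc; elim=> // i IH; rewrite (leq_ltn_trans IH)//; exact: kinc.
Qed.

Lemma strictly_increasing_comp k l : strictly_increasing k ->
  strictly_increasing l -> strictly_increasing (k \o l).
Proof. by move=> kinc linc i j /linc/kinc. Qed.

Section Blocks.

Lemma blocks_lt E i j k l : blocks E -> (i < j)%N -> k \in E i -> l \in E j ->
  (k < l)%N.
Proof.
move=> [E0 EE] ij; rewrite -(subnKC ij); elim: (j - i.+1)%N l => [|d IH] l kE.
  by rewrite addn0 => lE; apply: EE kE lE.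
rewrite addnS => lE; have [p pE] := fset0Pn _ (E0 (i.+1 + d)%N).
by rewrite (ltn_trans (IH _ kE pE))//; exact: EE pE lE.
Qed.

(** A bound separating the first [m] blocks from the others. *)
Lemma blocks_cut E m : blocks E -> exists M,
  (forall i k, (i < m)%N -> k \in E i -> (k < M)%N) /\
  (forall i k, (m <= i)%N -> k \in E i -> (M <= k)%N).
Proof.
move=> bE; have [E0 EE] := bE.
have h : exists k, k \in E m by have [p pE] := fset0Pn _ (E0 m); exists p.
exists (ex_minn h); case: ex_minnP => M ME Mmin; split=> i k.
  by move=> im kE; exact: blocks_lt im kE ME.
rewrite leq_eqVlt => /predU1P[<-|mi] kE; first exact: Mmin.
by apply/ltnW/(blocks_lt bE mi).
Qed.

Lemma strictly_increasing_blocks k : strictly_increasing k ->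
  blocks (fun i => [fset k i]%fset).
Proof.
move=> kinc; split=> [i|i p q]; first by apply/fset0Pn; exists (k i); rewrite inE.
by rewrite !inE => /eqP -> /eqP ->; exact: kinc.
Qed.

End Blocks.

Section BlockSums.
Variables (R : realType) (V : normedModType R).
Implicit Types (x : nat -> V) (E : nat -> {fset nat}) (b : nat -> R).

(** The constant coefficient block supported by [A]. *)
Definition block_sum x (A : {fset nat}) : V := \sum_(k <- A) x k.

Lemma block_sum1 x k : block_sum x [fset k]%fset = x k.
Proof. by rewrite /block_sum big_seq_fset1. Qed.

Lemma block_sumE x (A : {fset nat}) M : (forall k, k \in A -> (k < M)%N) ->
  block_sum x A = lin_comb x (fun k => (k \in A)%:R) M.
Proof.
move=> AM; rewrite /block_sum /lin_comb.
rewrite -(big_mkord xpredT (fun k => (k \in A)%:R *: x k)).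
under [RHS]eq_bigr do rewrite scaler_nat mulrb.
rewrite -big_mkcond -[RHS]big_filter; apply: perm_big; apply: uniq_perm.
- exact: fset_uniq.
- by rewrite filter_uniq// iota_uniq.
- move=> k; rewrite mem_filter mem_iota /= subn0 add0n.
  by case: (boolP (k \in A)) => // /AM ->.
Qed.

(** The coefficients with respect to [x] of the combination of the first [n]
    block sums with coefficients [b]. *)
Definition block_coef E b n : nat -> R :=
  fun k => \sum_(i < n) b i * (k \in E i)%:R.

Lemma lin_comb_block_coef x E b n M :
  (forall i k, (i < n)%N -> k \in E i -> (k < M)%N) ->
  lin_comb x (block_coef E b n) M = lin_comb (block_sum x \o E) b n.
Proof.
elim: n => [|n IH] EM.
  rewrite lin_comb0 /lin_comb big1// => i _.
  by rewrite /block_coef big_ord0 scale0r.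
rewrite lin_combS -IH; last by move=> i k im; apply: EM; exact: ltnW.
rewrite /= (block_sumE x (M := M)); last by move=> k; exact: EM.
rewrite -lin_combZ -lin_combD; apply: eq_lin_comb => i _.
by rewrite /block_coef big_ord_recr.
Qed.

Lemma grunblum_block_sum K x E : blocks E -> grunblum K x ->
  grunblum K (block_sum x \o E).
Proof.
move=> bE gK b m n mn.
(* The combination of the first [m] block sums is an initial segment, of
   length [M], of the combination of the first [n] ones. *)
have [N [N1 N2]] := blocks_cut n bE.
have [M [M1 M2 MN]] : exists M, [/\
    forall i k, (i < m)%N -> k \in E i -> (k < M)%N,
    forall i k, (m <= i)%N -> (i < n)%N -> k \in E i -> (M <= k)%N & (M <= N)%N].
  move: mn; rewrite leq_eqVlt => /predU1P[->|mn].
    by exists N; split=> // i k ni; rewrite ltnNge ni.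
  have [M [M1 M2]] := blocks_cut m bE; exists M; split=> // [i k mi _|].
    exact: M2.
  have [p pE] := fset0Pn _ (bE.1 m).
  by apply: (leq_trans (M2 m p (leqnn _) pE)); apply/ltnW/(N1 m).
rewrite -(lin_comb_block_coef x b N1) -(lin_comb_block_coef x b M1).
suff -> : lin_comb x (block_coef E b m) M = lin_comb x (block_coef E b n) M.
  exact: gK.
apply: eq_lin_comb => k kM; congr (_ *: _).
rewrite /block_coef -(subnKC mn) big_split_ord /= [X in _ = _ + X]big1 ?addr0//.
move=> i _; case: (boolP (k \in _)) => [kE|]; last by rewrite mulr0.
have imn : (m + i < n)%N by rewrite -ltn_subRL.
by have := M2 (m + i)%N k (leq_addr _ _) imn kE; rewrite leqNgt kM.
Qed.

Lemma grunblum_scale K x (c : nat -> R) : grunblum K x ->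
  grunblum K (fun i => c i *: x i).
Proof.
move=> gK a m n mn.
have E k : lin_comb (fun i => c i *: x i) a k = lin_comb x (fun i => a i * c i) k.
  by apply: eq_lin_comb => i _; rewrite scalerA.
by rewrite !E; exact: gK.
Qed.

Lemma grunblum_subsequence K x k : strictly_increasing k -> grunblum K x ->
  grunblum K (x \o k).
Proof.
move=> kinc /(grunblum_block_sum (strictly_increasing_blocks kinc)).
by congr (grunblum K); apply/funext => i /=; rewrite block_sum1.
Qed.

Lemma nccbP x y : nccb x y <-> exists2 E, blocks E &
  y = (fun i => `|block_sum x (E i)|^-1 *: block_sum x (E i)).
Proof.
split=> [[E [E0 EE yE]]|[E [E0 EE] ->]].
  by exists E => //; apply/funext.
by exists E.
Qed.

End BlockSums.

Section Factorial.

Lemma sum_fact_le m : (\sum_(k < m) k`! <= m`!)%N.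
Proof.
case: m => [|m]; first by rewrite big_ord0.
elim: m => [|m IH]; first by rewrite big_ord_recr big_ord0.
rewrite big_ord_recr /= (leq_trans (leq_add IH (leqnn _)))//.
by rewrite addnn -mul2n factS leq_mul2r orbT.
Qed.

Lemma muln_sum_fact_le m : (m * \sum_(k < m) k`! <= 2 * m`!)%N.
Proof.
case: m => [|m]; first by rewrite mul0n.
rewrite big_ord_recr /= factS mulnCA leq_mul2l /= mul2n -addnn leq_add2r.
exact: sum_fact_le.
Qed.

End Factorial.

Section FirstPart.
Variables (R : realType) (X : normedModType R).

Lemma dist_normalize (u v : X) : `|v| = 1 -> u != 0 ->
  `| `|u|^-1 *: u - v| <= 2 * `|u - v|.
Proof.
move=> v1 u0; have nu : `|u| != 0 by rewrite normr_eq0.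
rewrite (le_trans (ler_distD u _ _))// mulr_natl mulr2n lerD2r.
have -> : `|u|^-1 *: u - u = (1 - `|u|) *: (`|u|^-1 *: u).
  by rewrite scalerBl scale1r scalerA divff// scale1r.
rewrite normrZ normrZ normfV normr_id mulVf// mulr1 -v1.
by rewrite distrC ler_dist_dist.
Qed.

(** With the weights [k`!], a block sum is dominated by its last term. The
    factor [m%:R] on the left avoids a separate case [m = 0]. *)
Lemma factorial_block_dist (z : nat -> X) (A : {fset nat}) m : normalized z ->
  m \in A -> (forall k, k \in A -> (k <= m)%N) ->
  let s := block_sum (fun k => k`!%:R *: z k) A in s != 0 ->
  m%:R * `| `|s|^-1 *: s - z m| <= 4.
Proof.
move=> z1 mA Am s s0.
have f0 : 0 < m`!%:R :> R by rewrite ltr0n fact_gt0.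
pose u := m`!%:R^-1 *: s.
have u0 : u != 0 by rewrite scaler_eq0 negb_or invr_eq0 gt_eqF.
have -> : `|s|^-1 *: s = `|u|^-1 *: u.
  rewrite /u normrZ ger0_norm ?invr_ge0 ?ltW// invfM invrK scalerA.
  by rewrite mulrAC divff ?gt_eqF// mul1r.
have us : `|u - z m| <= m`!%:R^-1 * (\sum_(k < m) k`!)%:R.
  have -> : u - z m = m`!%:R^-1 *: (s - m`!%:R *: z m).
    by rewrite scalerBr scalerA mulVf ?gt_eqF// scale1r.
  rewrite normrZ normfV normr_nat ler_pM2l ?invr_gt0//.
  rewrite /s (block_sumE _ (M := m.+1))// lin_combS mA scale1r addrK.
  rewrite (le_trans (norm_lin_comb_le _ _ _))// natr_sum ler_sum// => i _.
  rewrite normrZ z1 mulr1 !normr_nat; case: (_ \in _); first by rewrite mul1r.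
  by rewrite mul0r.
have := dist_normalize (z1 m) u0.
have := muln_sum_fact_le m; rewrite -(ler_nat R) !natrM => h hd.
rewrite (@le_trans _ _ (m%:R * (2 * (m`!%:R^-1 * (\sum_(k < m) k`!)%:R))))//.
  by rewrite ler_wpM2l// (le_trans hd)// ler_wpM2l.
have -> : m%:R * (2 * (m`!%:R^-1 * (\sum_(k < m) k`!)%:R)) =
    2 * (m`!%:R^-1 * (m%:R * (\sum_(k < m) k`!)%:R)) :> R by ring.
have -> : 4 = 2 * (m`!%:R^-1 * (2 * m`!%:R)) :> R by field; rewrite gt_eqF.
by rewrite ler_pM2l// ler_pM2l ?invr_gt0.
Qed.

Theorem good_nccb_exists (hX : infinite_dimensional X) :
  exists x : nat -> X,
    basic_sequence x /\ (forall y : nat -> X, nccb x y -> good y).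
Proof.
have [z0 [z01 z0g]] := mazur hX.
have [kap [kinc zlim]] := brunel_sucheston z01.
pose z := z0 \o kap.
have z1 : normalized z by move=> i; exact: z01.
have zg : grunblum 2 z by exact: grunblum_subsequence.
pose x k : X := k`!%:R *: z k.
have xg : grunblum 2 x by exact: grunblum_scale.
have x0 k : x k != 0.
  by rewrite scaler_eq0 negb_or -normr_eq0 normr_nat pnatr_eq0 -lt0n fact_gt0
    -normr_eq0 z1 oner_eq0.
exists x; split; first exact: grunblum_basic xg.
move=> _ /nccbP[E bE ->]; set y := (fun i => _).
have s0 i : block_sum x (E i) != 0.
  have [m mE] := fset0Pn _ (bE.1 i).
  have [M [M1 _]] := blocks_cut i.+1 bE.
  have mM : (m < M)%N by exact: M1 (leqnn _) mE.
  have := grunblum_coef (fun k => (k \in E i)%:R) (ler0n _ 2) xg mM.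
  rewrite -block_sumE => [|k]; last by apply: M1.
  rewrite mE normr1 mul1r; apply: contraTneq => ->.
  by rewrite normr0 mulr0 -ltNge normr_gt0.
have y1 : normalized y.
  by move=> i; rewrite /y normrZ normfV normr_id mulVf// normr_eq0.
have y0 i : y i != 0 by rewrite -normr_gt0 y1.
have yg : grunblum 2 y by exact/grunblum_scale/grunblum_block_sum.
split=> //; first exact: grunblum_basic yg.
have /choice[m mP] i : exists m, m \in E i /\ forall k, k \in E i -> (k <= m)%N.
  have h : exists k, k \in E i by have [p pE] := fset0Pn _ (bE.1 i); exists p.
  have [M [M1 _]] := blocks_cut i.+1 bE.
  have h2 k : k \in E i -> (k <= M)%N by move=> kE; apply/ltnW/(M1 i).
  by exists (ex_maxn h h2); case: ex_maxnP.
have minc : strictly_increasing m.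
  by move=> i j ij; exact: blocks_lt bE ij (mP i).1 (mP j).1.
have ym i : (m i)%:R * `|y i - z (m i)| <= 4.
  by apply: factorial_block_dist => //; [exact: (mP i).1|exact: (mP i).2].
move=> n a; have [l lP] := zlim n a; exists l => eps eps0.
have eps2 : 0 < eps / 2 by rewrite divr_gt0.
have [N1 N1P] := lP _ eps2.
pose S := \sum_(i < n) `|a i| * 4.
have S0 : 0 <= S by apply: sumr_ge0 => i _; rewrite mulr_ge0.
have e'0 : 0 < eps / 2 / (S + 1) by rewrite divr_gt0// ltr_wpDl.
have [N2 N2P] := exists_natSinv_le e'0.
exists (maxn N1 N2.+1) => k kinc' kN.
have h1 := N1P (m \o k) (strictly_increasing_comp minc kinc').
have {}h1 := h1 (leq_trans (leq_trans (leq_maxl _ _) kN)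
  (strictly_increasing_ge minc _)).
have h2 : `|lin_comb (y \o k) a n - lin_comb (z \o (m \o k)) a n| <= eps / 2.
  have -> : lin_comb (y \o k) a n - lin_comb (z \o (m \o k)) a n =
      lin_comb (fun i => y (k i) - z (m (k i))) a n.
    by rewrite /lin_comb -sumrB; apply: eq_bigr => i _; rewrite scalerBr.
  rewrite (le_trans (norm_lin_comb_le _ _ _))//.
  rewrite (@le_trans _ _ (S * N2.+1%:R^-1))//.
    rewrite /S mulr_suml ler_sum// => i _.
    rewrite -mulrA ler_wpM2l// ler_pdivlMr// mulrC.
    rewrite (le_trans _ (ym (k i)))// ler_wpM2r// ler_nat.
    rewrite (leq_trans _ (strictly_increasing_ge minc _))//.
    rewrite (leq_trans (leq_trans (leq_maxr _ _) kN))//.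
    by case: (nat_of_ord i) => // j; apply/ltnW/kinc'.
  have S1 : 0 < S + 1 by rewrite ltr_wpDl.
  rewrite (@le_trans _ _ ((S + 1) * (eps / 2 / (S + 1))))//.
    by rewrite ler_pM ?lerDl// N2P.
  by rewrite mulrC divfK// gt_eqF.
rewrite (le_trans (ler_distD `|lin_comb (z \o (m \o k)) a n| _ _))//.
by rewrite [leRHS](splitr eps) lerD// (le_trans (ler_dist_dist _ _)).
Qed.

End FirstPart.

(** * The common limit of all block sequences *)

Section UniformLimit.
Variables (R : realType) (V : normedModType R).
Implicit Types (x : nat -> V) (E : nat -> {fset nat}) (a b : nat -> R).

(** All the sets [E i] lie in the half-line of the integers at least [N]. *)
Definition beyond (N : nat) E : Prop := forall i k, k \in E i -> (N <= k)%N.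

(** The NCCB vector supported by [A]. *)
Definition normalized_block_sum x (A : {fset nat}) : V :=
  `|block_sum x A|^-1 *: block_sum x A.

Lemma block_sum_normalized x A :
  `|block_sum x A| *: normalized_block_sum x A = block_sum x A.
Proof.
rewrite /normalized_block_sum scalerA; have [->|s0] := eqVneq (block_sum x A) 0.
  by rewrite scaler0.
by rewrite divff ?scale1r// normr_eq0.
Qed.

Lemma nccb_blocks x E : blocks E -> nccb x (normalized_block_sum x \o E).
Proof. by move=> bE; apply/nccbP; exists E. Qed.

Lemma beyond_shift_blocks k N : strictly_increasing k ->
  beyond N (fun i => [fset k (N + i)%N]%fset).
Proof.
move=> kinc i p; rewrite inE => /eqP ->.
by rewrite (leq_trans (leq_addr i N))// strictly_increasing_ge.
Qed.

Lemma shift_increasing N : strictly_increasing (fun i => (N + i)%N).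
Proof. by move=> i j; rewrite ltn_add2l. Qed.

(** Concatenation of finite pieces, each taken beyond the previous ones, into
    one sequence of blocks. *)
Lemma concat_blocks n (P : nat -> (nat -> {fset nat}) -> Prop) : (0 < n)%N ->
  (forall j N, exists T, [/\ blocks T, beyond N T & P j T]) ->
  exists2 E, blocks E &
    forall j, exists2 T, P j T & forall i, (i < n)%N -> E (j * n + i)%N = T i.
Proof.
move=> n0 hP.
have /choice[g gP] (p : nat * nat) : exists q : (nat -> {fset nat}) * nat,
    [/\ blocks q.1, beyond p.2 q.1, P p.1 q.1 &
        forall i k, (i < n)%N -> k \in q.1 i -> (k < q.2)%N].
  have [T [bT NT PT]] := hP p.1 p.2.
  by have [M [M1 _]] := blocks_cut n bT; exists (T, M).
pose N := fix N j := if j is i.+1 then (g (i, N i)).2 else 0%N.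
pose T j := (g (j, N j)).1.
exists (fun m => T (m %/ n)%N (m %% n)%N).
  split=> [m|m k l]; first exact:
    (let: And4 bT _ _ _ := gP ((m %/ n)%N, N (m %/ n)%N) in bT.1).
  have [bT _ _ TN] := gP ((m %/ n)%N, N (m %/ n)%N).
  rewrite {3 4}(divn_eq m n); set q := (m %/ n)%N; set r := (m %% n)%N.
  have rn : (r < n)%N by rewrite ltn_mod.
  rewrite -addnS divnMDl// modnMDl.
  move: rn; rewrite -ltnS leq_eqVlt ltnS => /predU1P[[rn]|rn].
    rewrite rn divnn n0 modnn addn1 => kT.
    have [_ NT _ _] := gP (q.+1, N q.+1) => lT.
    have rn' : (r < n)%N by rewrite ltn_mod.
    exact: (leq_trans (TN _ _ rn' kT) (NT _ _ lT)).
  rewrite divn_small// addn0 modn_small//.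
  exact: bT.2.
move=> j; exists (T j); first by have [] := gP (j, N j).
by move=> i ilt; rewrite divnMDl// modnMDl divn_small// modn_small// addn0.
Qed.

(** If all normalized constant coefficient block sequences are good, they all
    have the same limits: two block sequences can be interleaved into one. The
    limit is moreover uniform over all blocks far out. *)
Lemma uniform_limit x : (forall y, nccb x y -> good y) ->
  forall a n, exists F : R, forall e, 0 < e -> exists N, forall E, blocks E ->
    beyond N E -> `| `|lin_comb (normalized_block_sum x \o E) a n| - F| <= e.
Proof.
move=> xgood a [|n].
  exists 0 => e e0; exists 0%N => E _ _.
  by rewrite lin_comb0 subr0 !normr0 ltW.
pose val E := `|lin_comb (normalized_block_sum x \o E) a n.+1|.
have id_inc : strictly_increasing id by [].
have [_ _ /(_ n.+1 a)[l lP]] :=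
  xgood _ (nccb_blocks x (strictly_increasing_blocks id_inc)).
exists l => e e0; apply: contrapT => nN.
have e2 : 0 < e / 2 by rewrite divr_gt0.
have e8 : 0 < e / 8 by rewrite divr_gt0.
(* Even pieces are far from the limit [l] along singletons, odd pieces are
   close to it. *)
have [//|j N|E bE EP] := @concat_blocks n.+1 (fun j E =>
    if odd j then `|val E - l| <= e / 2 else e < `|val E - l|).
  case: (odd j).
    have [N0 N0P] := lP _ e2; pose M := maxn N0 N.
    have Minc := shift_increasing M.
    exists (fun i => [fset (M + i)%N]%fset); split.
    - exact: strictly_increasing_blocks.
    - move=> i k /(beyond_shift_blocks id_inc); apply: leq_trans.
      by rewrite leq_maxr.
    - by apply: (N0P _ Minc); rewrite addn0 leq_maxl.
  apply: contrapT => nE; apply: nN; exists N => E bE NE.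
  by rewrite leNgt; apply/negP => h; apply: nE; exists E.
have [_ _ /(_ n.+1 a)[l' l'P]] := xgood _ (nccb_blocks x bE).
have [N NP] := l'P _ e8.
have hj j T : (N <= j)%N -> (forall i, (i < n.+1)%N -> E (j * n.+1 + i)%N = T i) ->
    `|val T - l'| <= e / 8.
  move=> Nj ET.
  have := NP (fun i => (j * n.+1 + i)%N) (shift_increasing _) _.
  rewrite addn0 (leq_trans Nj) ?leq_pmulr// => /(_ isT).
  rewrite (@eq_lin_comb _ _ _ (normalized_block_sum x \o T) a a)// => i im.
  by rewrite /= ET.
have [T0 P0 E0] := EP N.*2; have [T1 P1 E1] := EP N.*2.+1.
have N2 : (N <= N.*2)%N by rewrite -addnn leq_addr.
have h0 := hj _ _ N2 E0; have h1 := hj _ _ (leqW N2) E1.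
rewrite odd_double in P0; rewrite /= odd_double /= in P1.
have := ler_distD l' (val T0) l; have := ler_distD (val T1) l' l.
rewrite (distrC l' (val T1)); lra.
Qed.

End UniformLimit.

(** * Unconditionality and the limit norm *)

Section Unconditional.
Variables (R : realType) (V : normedModType R).
Implicit Types (x : nat -> V) (a b : nat -> R).

(** Unconditionality with constant [K]. *)
Definition unconditional_with (K : R) x : Prop :=
  forall (n : nat) (a : nat -> R) (s : nat -> bool),
    `|lin_comb x (fun i => (-1) ^+ s i * a i) n| <= K * `|lin_comb x a n|.

(** The coefficients of [b] are replaced one at a time: as a function of one
    coefficient the norm is convex, so on [-|a i|, |a i|] it is largest at an
    end point. *)
Lemma unconditional_le K x a b n : unconditional_with K x ->
  (forall i, (i < n)%N -> `|b i| <= `|a i|) ->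
  `|lin_comb x b n| <= K * `|lin_comb x a n|.
Proof.
move=> xu ba.
suff main m c : (forall i, (i < m)%N -> `|c i| <= `|a i|) ->
    (forall i, (m <= i)%N -> exists s : bool, c i = (-1) ^+ s * a i) ->
    `|lin_comb x c n| <= K * `|lin_comb x a n|.
  rewrite (@eq_lin_comb _ _ x x b (fun i => if (i < n)%N then b i else a i)).
    apply: (main n) => i; first by move=> im; rewrite im ba.
    by rewrite leqNgt => /negbTE ->; exists false; rewrite expr0 mul1r.
  by move=> i ->.
elim: m c => [|m IH] c ca cs.
  have /choice[s sP] i := cs i (leq0n i).
  rewrite (@eq_lin_comb _ _ x x c (fun i => (-1) ^+ s i * a i))// => i _.
  by rewrite sP.
have [am0|am0] := eqVneq (a m) 0.
  apply: IH => i; first by move=> im; apply: ca; exact: ltnW.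
  rewrite leq_eqVlt => /predU1P[<-|]; last exact: cs.
  exists false; rewrite am0 mulr0; apply/eqP; rewrite -normr_le0.
  by rewrite (le_trans (ca m _))// am0 normr0.
pose cc (e : R) i := if i == m then e * a m else c i.
have IHc e : e \in [:: 1; -1] -> `|lin_comb x (cc e) n| <= K * `|lin_comb x a n|.
  move=> ee; apply: IH => i.
    by rewrite /cc; case: eqVneq => [->|_ /ltnW/ca//]; rewrite ltnn.
  rewrite leq_eqVlt eq_sym /cc => /orP[im|mi].
    rewrite im (eqP im); move: ee; rewrite !inE => /orP[]/eqP ->.
      by exists false; rewrite expr0.
    by exists true; rewrite expr1.
  by rewrite gtn_eqF//; exact: cs.
pose t := c m / a m.
have t1 : `|t| <= 1 by rewrite normrM normfV ler_pdivrMr ?mul1r ?normr_gt0// ca.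
have /andP[tl tr] : -1 <= t <= 1 by rewrite -ler_norml.
have -> : lin_comb x c n = ((1 + t) / 2) *: lin_comb x (cc 1) n +
    ((1 - t) / 2) *: lin_comb x (cc (-1)) n.
  rewrite -!lin_combZ -lin_combD; apply: eq_lin_comb => i _; congr (_ *: _).
  rewrite /cc; case: eqVneq => [->|_]; last by field.
  by rewrite /t; field.
have tl' : 0 <= (1 + t) / 2 by lra.
have tr' : 0 <= (1 - t) / 2 by lra.
rewrite (le_trans (ler_normD _ _))// (normrZ ((1 + t) / 2))
  (normrZ ((1 - t) / 2)) (ger0_norm tl') (ger0_norm tr').
have h1 := ler_wpM2l tl' (IHc 1 (mem_head _ _)).
have h2 : (1 - t) / 2 * `|lin_comb x (cc (- 1)) n| <=
    (1 - t) / 2 * (K * `|lin_comb x a n|).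
  by rewrite ler_wpM2l// IHc// !inE eqxx orbT.
rewrite (le_trans (lerD h1 h2))// -mulrDl.
by rewrite (_ : (1 + t) / 2 + _ = 1) ?mul1r//; field.
Qed.

Lemma unconditional_shift_scale K x (c : nat -> R) N : unconditional_with K x ->
  unconditional_with K (fun i => c i *: x (N + i)%N).
Proof.
move=> xu n a s.
have E b : lin_comb (fun i => c i *: x (N + i)%N) b n =
    lin_comb x (fun k => if (k < N)%N then 0 else b (k - N)%N * c (k - N)%N)
      (N + n).
  elim: n => [|n IH].
    rewrite addn0 lin_comb0 /lin_comb big1// => i _.
    by rewrite ltn_ord scale0r.
  rewrite addnS !lin_combS IH ltnNge leq_addr /= addKn.
  by rewrite scalerA.
rewrite !E; pose s' k := s (k - N)%N.
rewrite (@eq_lin_comb _ _ x x _ (fun k => (-1) ^+ s' k *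
  (if (k < N)%N then 0 else a (k - N)%N * c (k - N)%N))); first exact: xu.
by move=> k _; congr (_ *: _); case: ifP => _; rewrite ?mulr0// mulrA.
Qed.

End Unconditional.

Lemma sum_dist_cvg0 (R : realType) (c : nat -> nat -> R) (b : nat -> R) n :
  (forall j, (j < n)%N -> c M j @[M --> \oo] --> b j) ->
  (\sum_(j < n) `|c M j - b j|) @[M --> \oo] --> (0 : R).
Proof.
elim: n => [|n IH] cb.
  by under eq_fun do rewrite big_ord0; exact: cvg_cst.
have c0 := IH (fun j jn => cb j (ltnW jn)).
have c1 : `|c M n - b n| @[M --> \oo] --> `|b n - b n|.
  by apply: cvg_norm; apply: cvgB; [exact: cb|exact: cvg_cst].
have c2 : (\sum_(j < n) `|c M j - b j| + `|c M n - b n|) @[M --> \oo] -->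
  0 + `|b n - b n| by apply: cvgD.
rewrite subrr normr0 addr0 in c2.
by under eq_fun do rewrite big_ord_recr.
Qed.

(** In this section [F] is the common limit of all the block sequences of [x],
    and inherits the properties that their norms share. *)
Section LimitNorm.
Variables (R : realType) (V : normedModType R) (x : nat -> V).
Variable F : coef_norm R.
Hypothesis x_norm : forall E i, blocks E -> `|normalized_block_sum x (E i)| = 1.
Hypothesis F_lim : forall a n e, 0 < e -> exists N, forall E, blocks E ->
  beyond N E -> `| `|lin_comb (normalized_block_sum x \o E) a n| - F a n| <= e.
Implicit Types (a b : nat -> R).

(** [F b n] is also the limit when the coefficients vary and converge to [b]. *)
Lemma limit_norm_cvg (E : nat -> nat -> {fset nat}) (c : nat -> nat -> R) b n :
  (forall M, blocks (E M)) -> (forall M, beyond M (E M)) ->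
  (forall j, (j < n)%N -> c M j @[M --> \oo] --> b j) ->
  `|lin_comb (normalized_block_sum x \o E M) (c M) n| @[M --> \oo] --> F b n.
Proof.
move=> bE NE cb; apply/cvgrPdist_le => e e0.
have e2 : 0 < e / 2 by rewrite divr_gt0.
have [N NP] := F_lim b n e2.
have d0 := sum_dist_cvg0 cb.
move/cvgrPdist_le : d0 => /(_ _ e2) d0.
near=> M; rewrite distrC.
rewrite (le_trans
  (ler_distD `|lin_comb (normalized_block_sum x \o E M) b n| _ _))//.
rewrite [leRHS](splitr e) lerD//; last first.
  apply: NP => // i k /NE; apply: leq_trans.
  by near: M; exact: nbhs_infty_ge.
rewrite (le_trans (ler_dist_dist _ _))// -lin_combB.
rewrite (le_trans (norm_lin_comb_le _ _ _))//.
under eq_bigr do rewrite /= x_norm// mulr1.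
have : `|0 - \sum_(j < n) `|c M j - b j| | <= e / 2 by near: M.
by rewrite sub0r normrN ger0_norm// sumr_ge0.
Unshelve. all: by end_near. Qed.

Let sing M := fun i : nat => [fset (M + i)%N]%fset : {fset nat}.
Let h M a n := `|lin_comb (normalized_block_sum x \o sing M) a n|.

Let h_cvg a n : h M a n @[M --> \oo] --> F a n.
Proof.
apply: limit_norm_cvg => [M|M|j _]; last exact: cvg_cst.
- exact: strictly_increasing_blocks (shift_increasing M).
- by apply: (@beyond_shift_blocks id).
Qed.

Let y_norm M i : `|(normalized_block_sum x \o sing M) i| = 1.
Proof. exact: x_norm (strictly_increasing_blocks (shift_increasing M)). Qed.

Lemma limit_norm_ext a b n : (forall i, (i < n)%N -> a i = b i) -> F a n = F b n.
Proof.
move=> ab; apply: (cvg_unique _ (@h_cvg a n)) => //.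
rewrite (_ : h^~ a ^~ n = h^~ b ^~ n); first exact: h_cvg.
apply/funext => M; rewrite /h; congr (`|_|); apply: eq_lin_comb => i im.
by rewrite ab.
Qed.

Lemma limit_normZ c a n : F (fun i => c * a i) n = `|c| * F a n.
Proof.
apply: (cvg_unique _ (@h_cvg _ n)) => //.
rewrite (_ : (fun M => h M (fun i => c * a i) n) = (fun M => `|c| * h M a n)).
  by apply: cvgM; [exact: cvg_cst|exact: h_cvg].
by apply/funext => M; rewrite /h lin_combZ normrZ.
Qed.

Lemma limit_normD a b n : F (fun i => a i + b i) n <= F a n + F b n.
Proof.
apply: (ler_cvg_to (@h_cvg (fun i => a i + b i) n)
  (cvgD (@h_cvg a n) (@h_cvg b n))).
by apply: nearW => M; rewrite /h lin_combD ler_normD.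
Qed.

Lemma limit_norm_widen a m n : (m <= n)%N ->
  (forall i, (m <= i)%N -> a i = 0) -> F a n = F a m.
Proof.
move=> mn a0; apply: (cvg_unique _ (@h_cvg a n)) => //.
rewrite (_ : h^~ a ^~ n = h^~ a ^~ m); first exact: h_cvg.
by apply/funext => M; rewrite /h (lin_comb_widen _ mn).
Qed.

Lemma limit_norm_ge0 a n : 0 <= F a n.
Proof.
apply: (ler_cvg_to (cvg_cst 0) (@h_cvg a n)).
by apply: nearW => M; rewrite /h.
Qed.

Lemma limit_norm_le_sum a n : F a n <= \sum_(i < n) `|a i|.
Proof.
apply: (ler_cvg_to (@h_cvg a n) (cvg_cst _)); apply: nearW => M.
rewrite (le_trans (norm_lin_comb_le _ _ _))//.
by under eq_bigr do rewrite y_norm mulr1.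
Qed.

Lemma limit_norm_unit a n j : (j < n)%N ->
  F (fun i => if i == j then a j else 0) n = `|a j|.
Proof.
move=> jn; apply: (cvg_unique _ (@h_cvg _ n)) => //.
rewrite (_ : (fun M => _) = (fun M : nat => `|a j|)); first exact: cvg_cst.
apply/funext => M; rewrite /h /lin_comb (bigD1 (Ordinal jn))//= eqxx big1.
  by rewrite addr0 normrZ y_norm mulr1.
by move=> i; rewrite -val_eqE /= => /negbTE ->; rewrite scale0r.
Qed.

Lemma limit_norm_unconditional K a b n : unconditional_with K x ->
  (forall i, (i < n)%N -> `|b i| <= `|a i|) -> F b n <= K * F a n.
Proof.
move=> xu ba.
have hM M : h M b n <= K * h M a n.
  rewrite /h; have -> : normalized_block_sum x \o sing M = (fun i =>
      `|x (M + i)%N|^-1 *: x (M + i)%N).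
    by apply/funext => i; rewrite /= /normalized_block_sum block_sum1.
  apply: unconditional_le ba.
  exact: (@unconditional_shift_scale _ _ _ _ (fun i => `|x (M + i)%N|^-1)).
apply: (ler_cvg_to (@h_cvg b n) (cvgM (cvg_cst K) (@h_cvg a n))).
by apply: nearW => M; exact: hM.
Qed.

(** A spreading model generated by a block sequence induces the norm [F]. *)
Lemma spreading_model_limit_norm y (S : completeNormedModType R) (e : nat -> S) :
  nccb x y -> spreading_model y e -> forall a n, norm_of e a n = F a n.
Proof.
move=> /nccbP[E bE ->] [_ _ _ sm] a n; rewrite /norm_of.
pose T := 1 + \sum_(i < n) `|a i|.
have T0 : 0 < T by rewrite ltr_wpDr// sumr_ge0.
pose b i := T^-1 * a i.
have b1 i : (i < n)%N -> -1 <= b i <= 1.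
  move=> im; rewrite -ler_norml normrM gtr0_norm ?invr_gt0// ler_pdivrMl// mulr1.
  rewrite /T (bigD1 (Ordinal im))//= addrCA lerDl addr_ge0// sumr_ge0//.
suff eqb : `|lin_comb e b n| = F b n.
  have aE : a = (fun i => T * b i).
    by apply/funext => i; rewrite /b mulrA divff ?mul1r ?gt_eqF.
  by rewrite aE lin_combZ normrZ limit_normZ eqb.
apply/eqP; rewrite -subr_eq0 -normr_le0; apply/ler_addgt0Pl => d d0.
rewrite addr0.
have d2 : 0 < d / 2 by rewrite divr_gt0.
have [N1 N1P] := sm _ n d2; have [N2 N2P] := F_lim b n d2.
pose N := maxn N1 N2.
have h1 := N1P b _ b1 (shift_increasing N).
rewrite addn0 leq_maxl in h1; have {}h1 := h1 isT.
have bEN : blocks (fun i => E (N + i)%N).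
  by split=> [i|i]; [exact: bE.1|rewrite addnS; exact: bE.2].
have h2 := N2P _ bEN.
have {}h2 := h2 _; rewrite distrC in h1.
rewrite [leRHS](splitr d).
apply: (le_trans (ler_distD _ _ _)); apply: lerD (h1) (h2 _).
move=> i k kE; rewrite (leq_trans (leq_maxr N1 N2))//.
rewrite (leq_trans (leq_addr i _))//.
elim: (N + i)%N k kE => // j IH k kE.
have [p pE] := fset0Pn _ (bE.1 j).
by rewrite (leq_ltn_trans (IH _ pE))//; exact: bE.2 pE kE.
Qed.

End LimitNorm.

(** * The fundamental function *)

Section FundamentalFunction.
Variables (R : realType) (V : normedModType R) (x : nat -> V).
Variable F : coef_norm R.
Hypothesis x_norm : forall E i, blocks E -> `|normalized_block_sum x (E i)| = 1.
Hypothesis F_lim : forall a n e, 0 < e -> exists N, forall E, blocks E ->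
  beyond N E -> `| `|lin_comb (normalized_block_sum x \o E) a n| - F a n| <= e.
Variables (kap : nat -> nat) (c : R).
Hypothesis kap_inc : strictly_increasing kap.
Hypothesis c_gt0 : 0 < c.
Hypothesis kap_cvg : `|x (kap i)| @[i --> \oo] --> c.

(** The fundamental function of a norm: the norm of the sum of the first [n]
    unit vectors. *)
Definition fundamental (G : coef_norm R) (n : nat) : R := G (fun=> 1) n.

Let segment M p n : V := \sum_(i < n) x (kap (M + p + i)%N).

Let segment_cvg p n : `|segment M p n| @[M --> \oo] --> c * fundamental F n.
Proof.
pose E M i : {fset nat} := [fset kap (M + p + i)%N]%fset.
have inc M : strictly_increasing (fun i => kap (M + p + i)%N).
  exact: strictly_increasing_comp kap_inc (shift_increasing _).
have -> : c * fundamental F n = F (fun=> c) n.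
  rewrite -[c in LHS]gtr0_norm// /fundamental -(limit_normZ x_norm F_lim).
  by apply: (limit_norm_ext x_norm F_lim) => i _; rewrite mulr1.
have := @limit_norm_cvg _ _ _ _ x_norm F_lim E
  (fun M j => `|x (kap (M + p + j)%N)|) (fun=> c) n.
have EE M : lin_comb (normalized_block_sum x \o E M)
    (fun j => `|x (kap (M + p + j)%N)|) n = segment M p n.
  apply: eq_bigr => i _ /=; rewrite -(block_sum1 x (kap _)).
  exact: block_sum_normalized.
under eq_fun do rewrite EE.
apply=> [M|M|j _].
- exact: strictly_increasing_blocks.
- move=> i k; rewrite inE => /eqP ->.
  rewrite (leq_trans _ (strictly_increasing_ge kap_inc _))// -addnA.
  exact: leq_addr.
- have cv : (fun M => M + (p + j))%N @ \oo --> \oo by exact: cvg_addnr.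
  rewrite (_ : (fun M => `|x (kap (M + p + j)%N)|) =
      (fun i => `|x (kap i)|) \o (fun M => M + (p + j))%N).
    exact: cvg_comp cv kap_cvg.
  by apply/funext => M /=; rewrite addnA.
Qed.

(** The blocks of prescribed lengths [N 0], [N 1], ... cut out of the
    subsequence [kap] from index [M] on. *)
Let cut (N : nat -> nat) (M j : nat) : {fset nat} :=
  [fset k in map (fun i => kap (M + \sum_(l < j) N l + i)%N) (iota 0 (N j))]%fset.

Let cutP N M j k : reflect (exists2 i, (i < N j)%N &
  k = kap (M + \sum_(l < j) N l + i)%N) (k \in cut N M j).
Proof.
rewrite inE; apply: (iffP mapP) => [[i]|[i im ->]]; last first.
  by exists i; rewrite // mem_iota.
by rewrite mem_iota => im ->; exists i.
Qed.

Let block_sum_cut N M j :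
  block_sum x (cut N M j) = segment M (\sum_(l < j) N l) (N j).
Proof.
rewrite /segment -(big_mkord xpredT (fun i => x (kap (M + _ + i)%N))).
rewrite /index_iota subn0 -[RHS](big_map _ xpredT x).
apply: perm_big; apply: uniq_perm; first exact: fset_uniq.
  rewrite map_inj_uniq ?iota_uniq// => i i' eqk.
  by have [/kap_inc|/kap_inc|/addnI//] :=
    ltngtP (M + \sum_(l < j) N l + i)%N (M + \sum_(l < j) N l + i')%N;
    rewrite eqk ltnn.
by move=> k; rewrite inE.
Qed.

Let sum_block_sum_cut N M m :
  \sum_(j < m) block_sum x (cut N M j) = segment M 0 (\sum_(l < m) N l).
Proof.
elim: m => [|m IH]; first by rewrite /segment !big_ord0.
rewrite big_ord_recr IH /= block_sum_cut big_ord_recr /= /segment.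
rewrite big_split_ord /=; congr (_ + _); apply: eq_bigr => i _.
by rewrite addn0 addnA.
Qed.

Let blocks_cut_lengths N M : (forall j, (0 < N j)%N) -> blocks (cut N M).
Proof.
move=> N0; split=> [j|j k l /cutP[i im ->] /cutP[i' _ ->]].
  apply/fset0Pn; exists (kap (M + \sum_(l < j) N l + 0)%N).
  by apply/cutP; exists 0%N.
apply: kap_inc; rewrite big_ord_recr /= addnA.
by rewrite ltn_addr// ltn_add2l.
Qed.

(** Blocks of lengths [N j], once normalized, generate the same limit norm as
    single vectors do; but their sum is a sum of [\sum_j N j] single vectors. *)
Lemma fundamental_sum N m : (forall j, (0 < N j)%N) ->
  F (fun j => fundamental F (N j)) m = fundamental F (\sum_(j < m) N j).
Proof.
move=> N0; apply: (@mulfI _ c); first by rewrite gt_eqF.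
have h1 := @segment_cvg 0%N (\sum_(j < m) N j).
apply: (cvg_unique _ _ h1) => //.
have -> : c * F (fun j => fundamental F (N j)) m =
    F (fun j => c * fundamental F (N j)) m.
  by rewrite (limit_normZ x_norm F_lim) gtr0_norm.
have EE M : lin_comb (normalized_block_sum x \o cut N M)
    (fun j => `|block_sum x (cut N M j)|) m = segment M 0 (\sum_(l < m) N l).
  rewrite -sum_block_sum_cut; apply: eq_bigr => i _ /=.
  exact: block_sum_normalized.
have := @limit_norm_cvg _ _ _ _ x_norm F_lim (cut N)
  (fun M j => `|block_sum x (cut N M j)|) (fun j => c * fundamental F (N j)) m.
under eq_fun do rewrite EE.
apply=> [M|M|j _].
- exact: blocks_cut_lengths.
- move=> i k /cutP[i' _ ->].
  rewrite (leq_trans _ (strictly_increasing_ge kap_inc _))// -addnA.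
  exact: leq_addr.
- by under eq_fun do rewrite block_sum_cut; exact: segment_cvg.
Qed.

Lemma fundamental1 : fundamental F 1 = 1.
Proof.
have := @limit_norm_unit _ _ _ _ x_norm F_lim (fun=> 1) 1 0%N erefl.
rewrite normr1 /fundamental => {2}<-.
by apply: (limit_norm_ext x_norm F_lim) => -[].
Qed.

Lemma fundamentalM m n : (0 < n)%N ->
  fundamental F (m * n) = fundamental F m * fundamental F n.
Proof.
move=> n0; have := @fundamental_sum (fun=> n) m (fun=> n0).
rewrite sum_nat_const card_ord => <-.
have -> : F (fun=> fundamental F n) m = F (fun i => fundamental F n * 1) m.
  by apply: (limit_norm_ext x_norm F_lim) => i _; rewrite mulr1.
rewrite (limit_normZ x_norm F_lim) mulrC ger0_norm//.
exact: (limit_norm_ge0 x_norm F_lim).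
Qed.

Lemma fundamental_le n : fundamental F n <= n%:R.
Proof.
apply: (le_trans (limit_norm_le_sum x_norm F_lim _ _)).
under eq_bigr do rewrite normr1.
by rewrite sumr_const card_ord.
Qed.

(** Unconditionality makes the fundamental function monotone up to [K]. *)
Lemma fundamental_widen K m n : unconditional_with K x -> (m <= n)%N ->
  fundamental F m <= K * fundamental F n.
Proof.
move=> xu mn; pose b i : R := if (i < m)%N then 1 else 0.
have -> : fundamental F m = F b n.
  rewrite (limit_norm_widen x_norm F_lim mn) => [|i]; last first.
    by rewrite /b leqNgt => /negbTE ->.
  by apply: (limit_norm_ext x_norm F_lim) => i im; rewrite /b im.
apply: (limit_norm_unconditional x_norm F_lim xu) => i _.
by rewrite /b; case: ifP => _; rewrite ?normr0 normr1.
Qed.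

End FundamentalFunction.

(** * Power law and comparison with c_0 and l_p *)

Section PowerLaw.
Variable R : realType.

(** A constant factor does not matter in the comparison of all powers. *)
Lemma pow_growth_le (A B C : R) : 0 < B ->
  (forall k, A ^+ k <= C * B ^+ k) -> A <= B.
Proof.
move=> B0 h; rewrite leNgt; apply/negP => BA.
pose d := A / B - 1.
have d0 : 0 < d by rewrite subr_gt0 ltr_pdivlMr// mul1r.
have bern k : 1 + k%:R * d <= (A / B) ^+ k.
  elim: k => [|k IH]; first by rewrite mul0r addr0 expr0.
  have AB : A / B = 1 + d by rewrite /d addrC subrK.
  rewrite exprS AB; rewrite AB in IH.
  have d1 : 0 <= 1 + d by rewrite addr_ge0// ltW.
  apply: (le_trans _ (ler_wpM2l d1 IH)).
  have : 0 <= k%:R * (d * d) by rewrite !mulr_ge0// ltW.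
  rewrite -natr1; lra.
have hC k : k%:R * d <= C.
  have := bern k; rewrite expr_div_n ler_pdivlMr ?exprn_gt0// => hk.
  have := le_trans hk (h k); rewrite ler_pM2r ?exprn_gt0//; lra.
have := hC (Num.truncn (C / d)).+1.
by rewrite -ler_pdivlMr// leNgt truncnS_gt.
Qed.

(** Two monotone functions compatible with powers and equal at [2] agree, by
    comparison with the powers of [2] next to [n ^ k] for large [k]. *)
Lemma power_compare (f g : nat -> R) :
  (forall n k, (0 < n)%N -> f (n ^ k)%N = f n ^+ k) ->
  (forall n k, (0 < n)%N -> g (n ^ k)%N = g n ^+ k) ->
  (forall m n, (0 < m)%N -> (m <= n)%N -> f m <= f n) ->
  (forall m n, (0 < m)%N -> (m <= n)%N -> g m <= g n) ->
  (forall n, (0 < n)%N -> 0 < g n) -> f 2 = g 2 ->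
  forall n, (0 < n)%N -> f n <= g n.
Proof.
move=> fX gX fm gm g0 fg n n0; apply: (@pow_growth_le _ _ (g 2)); first exact: g0.
move=> k; rewrite -fX// -gX//; set m := (n ^ k)%N.
have m0 : (0 < m)%N by rewrite expn_gt0 n0.
have /andP[h1 h2] := @trunc_log_bounds 2 m erefl m0.
rewrite (le_trans (fm _ _ m0 (ltnW h2)))// fX// fg exprS ler_pM2l ?g0//.
by rewrite -gX// gm// expn_gt0.
Qed.

(** A multiplicative function that is monotone up to a constant factor is
    monotone, hence a power. *)
Lemma multiplicative_power_law (K : R) (lam : nat -> R) : lam 1 = 1 ->
  (forall m n, (0 < n)%N -> lam (m * n)%N = lam m * lam n) ->
  (forall n, lam n <= n%:R) ->
  (forall m n, (m <= n)%N -> lam m <= K * lam n) ->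
  exists al : R, [/\ 0 <= al, al <= 1 &
    forall n, (0 < n)%N -> lam n = n%:R `^ al].
Proof.
move=> lam1 lamM lamn lamK.
have K1 : 1 <= K by have := lamK 1%N 1%N (leqnn _); rewrite lam1 mulr1.
have K0 : 0 < K by rewrite (lt_le_trans _ K1).
have lam0 n : (0 < n)%N -> 0 < lam n.
  by move=> /lamK; rewrite lam1 => h; rewrite -(pmulr_rgt0 _ K0) (lt_le_trans _ h).
have lamX n k : (0 < n)%N -> lam (n ^ k)%N = lam n ^+ k.
  move=> n0; elim: k => [|k IH]; first by rewrite expn0 expr0.
  by rewrite expnS lamM ?expn_gt0 ?n0// IH exprS.
have lam_mono m n : (0 < m)%N -> (m <= n)%N -> lam m <= lam n.
  move=> m0 mn; have n0 := leq_trans m0 mn.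
  apply: (@pow_growth_le _ _ K); first exact: lam0.
  by move=> k; rewrite -!lamX//; apply: lamK; case: k => // k; rewrite leq_exp2r.
pose al := ln (lam 2%N) / ln 2.
have ln20 : 0 < ln 2 :> R by rewrite ln_gt0// ltr1n.
have al2 : 2 `^ al = lam 2%N.
  by rewrite /powR gt_eqF// /al divfK ?gt_eqF// lnK// posrE lam0.
have al0 : 0 <= al.
  by apply: divr_ge0; [apply: ln_ge0; rewrite -lam1 lam_mono|exact: ltW].
have al1 : al <= 1.
  by rewrite ler_pdivrMr// mul1r ler_ln ?posrE ?lam0// lamn.
exists al; split=> // n n0.
pose q (m : nat) : R := m%:R `^ al.
have qX m k : (0 < m)%N -> q (m ^ k)%N = q m ^+ k.
  by move=> m0; rewrite /q natrX -powR_mulrn// powRAC powR_mulrn// powR_ge0.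
have q_mono m k : (0 < m)%N -> (m <= k)%N -> q m <= q k.
  by move=> m0 mk; apply: ge0_ler_powR; rewrite ?nnegrE// ler_nat.
have q0 m : (0 < m)%N -> 0 < q m by move=> m0; rewrite powR_gt0// ltr0n.
apply/le_anti/andP; split.
  exact: (@power_compare lam q).
exact: (@power_compare q lam).
Qed.

End PowerLaw.

(** In this section [F] is an unconditional norm whose fundamental function is
    [n `^ al] and which satisfies the grouping identity [F_sum]. *)
Section CompareNorms.
Variables (R : realType) (F : coef_norm R) (K al : R).
Hypothesis K_ge1 : 1 <= K.
Hypothesis FZ : forall c a n, F (fun i => c * a i) n = `|c| * F a n.
Hypothesis FD : forall a b n, F (fun i => a i + b i) n <= F a n + F b n.
Hypothesis F_ge0 : forall a n, 0 <= F a n.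
Hypothesis F_le_sum : forall a n, F a n <= \sum_(i < n) `|a i|.
Hypothesis F_unit : forall a n j, (j < n)%N ->
  F (fun i => if i == j then a j else 0) n = `|a j|.
Hypothesis F_unc : forall a b n, (forall i, (i < n)%N -> `|b i| <= `|a i|) ->
  F b n <= K * F a n.
Hypothesis F_sum : forall N m, (forall j, (0 < N j)%N) ->
  F (fun j => fundamental F (N j)) m = fundamental F (\sum_(j < m) N j).
Hypothesis al_le1 : al <= 1.
Hypothesis F_pow : forall n, (0 < n)%N -> fundamental F n = n%:R `^ al.

Let K_gt0 : 0 < K. Proof. by rewrite (lt_le_trans _ K_ge1). Qed.

Lemma c0_equivalent : al = 0 -> equivalent K F (@c0_norm R).
Proof.
move=> al0 a n; apply/andP; split.
  rewrite ler_pdivrMl//; apply: bigmax_le; first by rewrite mulr_ge0// ltW.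
  move=> i _; rewrite -(F_unit a (ltn_ord i)); apply: F_unc => j jn.
  by case: eqP => [->//|_]; rewrite normr0.
pose m := c0_norm a n.
have m0 : 0 <= m by exact: bigmax_ge_id.
apply: (@le_trans _ _ (K * F (fun i => m * 1) n)).
  apply: F_unc => i im; rewrite mulr1 (ger0_norm m0).
  exact: (le_bigmax _ (fun i : 'I_n => `|a i|) (Ordinal im)).
rewrite ler_pM2l// FZ (ger0_norm m0) ler_piMr//.
case: n {m m0} => [|n].
  by rewrite (le_trans (F_le_sum _ _))// big_ord0.
by rewrite -[F _ _]/(fundamental F n.+1) F_pow// al0 powRr0.
Qed.

Section Positive.
Hypothesis al_gt0 : 0 < al.
Let al_ge0 : 0 <= al. Proof. exact: ltW. Qed.
Let p := al^-1.
Let S (a : nat -> R) n := \sum_(i < n) `|a i| `^ p.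

Let S_ge0 a n : 0 <= S a n.
Proof. by apply: sumr_ge0 => i _; exact: powR_ge0. Qed.

Let powK (t u : R) : 0 <= t -> (t * `|u| `^ p) `^ al = t `^ al * `|u|.
Proof.
move=> t0; rewrite powRM ?powR_ge0// -powRrM /p mulVf ?gt_eqF//.
by rewrite powRr1.
Qed.

Let pow2 (t : R) : 0 <= t -> (2 * t) `^ al <= 2 * t `^ al.
Proof.
move=> t0; rewrite powRM// ler_wpM2r ?powR_ge0//.
by rewrite -[leRHS]powRr1// ler_powR// ler1n.
Qed.

(** With [T] so large that [n / T <= S a n], rounding [T * |a j| ^ p] up to
   integers at most doubles their sum. *)
Let lp_upper a n : F a n <= 2 * K * S a n `^ al.
Proof.
have := S_ge0 a n; rewrite le_eqVlt => /predU1P[S0|S0].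
  rewrite (@le_trans _ _ 0) ?mulr_ge0 ?powR_ge0 ?(ltW K_gt0)//.
  rewrite (le_trans (F_le_sum _ _))//; apply: sumr_le0 => i _.
  have /eqP := esym S0; rewrite psumr_eq0; last by move=> j _; exact: powR_ge0.
  move/allP => /(_ i (mem_index_enum _)) /= /eqP/powR_eq0_eq0 ->.
  by [].
have n0 : (0 < n)%N.
  by case: n S0 => //; rewrite /S big_ord0 ltxx.
pose T := (Num.truncn (n%:R / S a n)).+1.
have T0 : 0 < T%:R :> R by [].
have TS : n%:R <= T%:R * S a n.
  by rewrite -ler_pdivrMr//; apply/ltW/truncnS_gt.
pose N j := (Num.truncn (T%:R * `|a j| `^ p)).+1.
have NT j : T%:R * `|a j| `^ p <= (N j)%:R /\ (N j)%:R <= T%:R * `|a j| `^ p + 1.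
  split; first by apply/ltW/truncnS_gt.
  by rewrite -natr1 lerD2r truncn_le mulr_ge0// powR_ge0.
have Ta : 0 < T%:R `^ al by rewrite powR_gt0.
rewrite -(ler_pM2l Ta) -[X in X * F a n](ger0_norm (ltW Ta)) -FZ.
have h1 : F (fun i => T%:R `^ al * a i) n <=
    K * F (fun j => fundamental F (N j)) n.
  apply: F_unc => i _; rewrite F_pow// normrM (ger0_norm (ltW Ta)).
  rewrite (ger0_norm (powR_ge0 (N i)%:R al)).
  rewrite -(powK (a i) (ler0n R T)).
  apply: ge0_ler_powR; rewrite ?nnegrE ?mulr_ge0 ?powR_ge0//.
  exact: (NT i).1.
have Ns0 : (0 < \sum_(j < n) N j)%N.
  by rewrite (bigD1 (Ordinal n0))//= addn_gt0.
rewrite (le_trans h1)// F_sum// F_pow//.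
rewrite [leRHS](_ : _ = K * (2 * (T%:R * S a n) `^ al)); last first.
  by rewrite powRM//; ring.
rewrite ler_pM2l//; apply: (le_trans _ (pow2 _)); last by rewrite mulr_ge0.
apply: ge0_ler_powR; rewrite ?nnegrE ?mulr_ge0//.
rewrite natr_sum (le_trans (ler_sum _ (fun (i : 'I_n) _ => (NT i).2)))//.
rewrite big_split /= sumr_const card_ord -mulr_sumr -/(S a n).
by rewrite [2 * _]mulr_natl mulr2n lerD2l; exact: TS.
Qed.

(** With [T] so large that [T * |a j| ^ p >= 1] for all [j], rounding these
   numbers down to integers at worst halves them. Null coefficients must be
   excluded because blocks are nonempty. *)
Let lp_lower_neq0 a n : (forall i, (i < n)%N -> a i != 0) ->
  S a n `^ al <= 2 * K * F a n.
Proof.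
case: n => [|n] an0.
  by rewrite /S big_ord0 powR0 ?gt_eqF// !mulr_ge0// ltW.
pose T := (\sum_(j < n.+1) (Num.truncn (`|a j| `^ p)^-1).+1)%N.
have ap j : (j < n.+1)%N -> 0 < `|a j| `^ p.
  by move=> jn; rewrite powR_gt0 ?normr_gt0 ?an0.
have T1 j : (j < n.+1)%N -> 1 <= T%:R * `|a j| `^ p.
  move=> jn; rewrite -ler_pdivrMr ?ap// div1r.
  apply/ltW/(lt_le_trans (truncnS_gt _)).
  by rewrite ler_nat /T (bigD1 (Ordinal jn))//= leq_addr.
have T0 : 0 < T%:R :> R.
  by rewrite ltr0n /T big_ord_recr addn_gt0 orbT.
clearbody T.
(* The maximum with [1] only matters for the irrelevant indices [j > n]. *)
pose N j := maxn 1 (Num.truncn (T%:R * `|a j| `^ p)).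
have N0 j : (0 < N j)%N by rewrite leq_max.
have NT j : (j < n.+1)%N -> (N j)%:R <= T%:R * `|a j| `^ p /\
    T%:R * `|a j| `^ p <= 2 * (N j)%:R.
  move=> jn; have h := T1 j jn.
  have -> : N j = Num.truncn (T%:R * `|a j| `^ p).
    by apply/maxn_idPr; rewrite truncn_gt0.
  split; first by rewrite truncn_le (le_trans _ h).
  rewrite (le_trans (ltW (truncnS_gt _)))// -natr1 [2 * _]mulr_natl mulr2n lerD2l.
  by rewrite ler1n truncn_gt0.
have Ta : 0 < T%:R `^ al by rewrite powR_gt0.
have h1 : F (fun j => fundamental F (N j)) n.+1 <=
    K * F (fun i => T%:R `^ al * a i) n.+1.
  apply: F_unc => i im; rewrite F_pow// normrM (ger0_norm (ltW Ta)).
  rewrite (ger0_norm (powR_ge0 (N i)%:R al)).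
  rewrite -(powK (a i) (ler0n R T)).
  apply: ge0_ler_powR; rewrite ?nnegrE ?mulr_ge0 ?powR_ge0//.
  exact: (NT i im).1.
rewrite F_sum// F_pow in h1; last by rewrite big_ord_recr addn_gt0 N0 orbT.
rewrite FZ (ger0_norm (ltW Ta)) in h1.
rewrite -(ler_pM2l Ta) -powRM ?(ltW T0)//.
rewrite [leRHS](_ : _ = 2 * (K * (T%:R `^ al * F a n.+1))); last by ring.
apply: (@le_trans _ _ (2 * (\sum_(j < n.+1) N j)%:R `^ al)); last first.
  by rewrite ler_pM2l.
apply: (le_trans _ (pow2 _)) => //.
apply: ge0_ler_powR; rewrite ?nnegrE ?mulr_ge0 ?(ltW T0)//.
rewrite natr_sum /S !mulr_sumr; apply: ler_sum => i _.
exact: (NT i (ltn_ord i)).2.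
Qed.

(** Null coefficients are replaced by a small [eta]. *)
Let lp_lower a n : S a n `^ al <= 2 * K * F a n.
Proof.
apply/ler_addgt0Pr => e e0.
have C0 : 0 < 2 * K * n.+1%:R by rewrite !mulr_gt0.
pose eta := e / (2 * K * n.+1%:R).
have eta0 : 0 < eta by rewrite divr_gt0.
pose b i := if a i == 0 then eta else 0.
have ab0 i : a i + b i != 0.
  rewrite /b; case: (eqVneq (a i) 0) => [->|ai0]; last by rewrite addr0.
  by rewrite add0r gt_eqF.
have Sab : S a n <= S (fun i => a i + b i) n.
  apply: ler_sum => i _; rewrite /b; case: eqP => [->|_]; last by rewrite addr0.
  by rewrite normr0 powR0 ?powR_ge0// invr_eq0 gt_eqF.
have powS : S a n `^ al <= S (fun i => a i + b i) n `^ al.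
  apply: ge0_ler_powR => //; rewrite nnegrE; exact: S_ge0.
apply: (le_trans powS); apply: (le_trans (lp_lower_neq0 (fun i _ => ab0 i))).
rewrite (@le_trans _ _ (2 * K * (F a n + F b n)))//.
  by rewrite ler_pM2l ?mulr_gt0.
rewrite mulrDr lerD2l.
have Fb : F b n <= n.+1%:R * eta.
  rewrite (le_trans (F_le_sum _ _))// (@le_trans _ _ (\sum_(i < n) eta))//.
    apply: ler_sum => i _; rewrite /b; case: ifP => _.
      by rewrite gtr0_norm.
    by rewrite normr0 ltW.
  by rewrite sumr_const card_ord -[leLHS]mulr_natl ler_pM2r// ler_nat.
rewrite (@le_trans _ _ (2 * K * (n.+1%:R * eta)))//.
  by rewrite ler_pM2l ?mulr_gt0.
by rewrite mulrA /eta mulrC divfK// gt_eqF.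
Qed.

Lemma lp_equivalent : equivalent (2 * K) F (lp_norm al^-1).
Proof.
move=> a n; rewrite /lp_norm invrK; apply/andP; split; last exact: lp_upper.
by rewrite ler_pdivrMl ?mulr_gt0//; exact: lp_lower.
Qed.

End Positive.

End CompareNorms.

Section SecondPart.
Variables (R : realType) (V : normedModType R).

Lemma semi_normalized_cvg_subsequence (x : nat -> V) : semi_normalized x ->
  exists (kap : nat -> nat) (c : R), [/\ strictly_increasing kap, 0 < c &
    `|x (kap i)| @[i --> \oo] --> c].
Proof.
move=> [inf0 [B hB]].
have xB i : `|x i| <= B by apply: hB; exists i.
have xinf i : inf (range (fun i => `|x i|)) <= `|x i|.
  by apply: ge_inf; [exists 0 => _ [j _ <-]|exists i].
have seg : \forall i \near \oo, `|x i| \in `[0, B].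
  by apply: nearW => i; rewrite in_itv /= normr_ge0 xB.
have [c [_ ccl]] := @segment_compact R 0 B ((fun i => `|x i|) @ \oo) _ seg.
have [kap kinc kc] := (cluster_eventually_cvg _ _).1 ccl.
exists kap, c; split=> //.
  by move=> i j ij; rewrite (leqW_mono kinc).
rewrite (lt_le_trans inf0)//; apply: (ler_cvg_to (cvg_cst _) kc).
by apply: nearW => i; exact: xinf.
Qed.

(** The equivalence of all spreading models of NCCB sequences with a single
    classical basis. *)
Theorem nccb_models_equivalent (x : nat -> V) :
  (forall y : nat -> V, nccb x y -> good y) ->
  semi_normalized x -> unconditional x ->
  exists2 C : R, 1 <= C &
    nccb_spreading_models_equivalent x C (@c0_norm R) \/
    (exists2 p : R, 1 <= p & nccb_spreading_models_equivalent x C (lp_norm p)).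
Proof.
move=> xgood xsemi [K0 xK0].
pose K := Num.max K0 1.
have K1 : 1 <= K by rewrite le_max lexx orbT.
have xK : unconditional_with K x.
  move=> n a s; rewrite (le_trans (xK0 n a s))// ler_wpM2r//.
  by rewrite le_max lexx.
have /choice[F0 F_lim] (a : nat -> R) : exists f : nat -> R, forall n e, 0 < e ->
    exists N, forall E, blocks E -> beyond N E ->
    `| `|lin_comb (normalized_block_sum x \o E) a n| - f n| <= e.
  by have /choice[f fP] := uniform_limit xgood a; exists f.
have x_norm E i : blocks E -> `|normalized_block_sum x (E i)| = 1.
  by move=> bE; have [/(_ i)] := xgood _ (nccb_blocks x bE).
have [kap [c [kinc c0 kc]]] := semi_normalized_cvg_subsequence xsemi.
have [al [al0 al1 lam_pow]] := multiplicative_power_law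
  (fundamental1 x_norm F_lim) (fundamentalM x_norm F_lim kinc c0 kc)
  (fundamental_le x_norm F_lim)
  (fun m n => fundamental_widen x_norm F_lim xK).
have FE := spreading_model_limit_norm x_norm F_lim.
have transfer C g : equivalent C F0 g -> nccb_spreading_models_equivalent x C g.
  by move=> eqF y xy S e ye a n; rewrite (FE _ _ _ xy ye); exact: eqF.
have F_unc a b n := @limit_norm_unconditional _ _ _ _ x_norm F_lim K a b n xK.
have F_sum := fundamental_sum x_norm F_lim kinc c0 kc.
move: al0; rewrite le_eqVlt => /predU1P[/esym al0|al0].
  exists K => //; left; apply: transfer; apply: (c0_equivalent (al := al)) => //.
  - exact: (limit_normZ x_norm F_lim).
  - exact: (limit_norm_ge0 x_norm F_lim).
  - exact: (limit_norm_le_sum x_norm F_lim).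
  - exact: (limit_norm_unit x_norm F_lim).
exists (2 * K).
  by rewrite (le_trans K1)// ler_peMl// ?ler1n// (le_trans _ K1).
right; exists al^-1; first by rewrite invf_ge1.
apply: transfer; apply: lp_equivalent => //.
- exact: (limit_normZ x_norm F_lim).
- exact: (limit_normD x_norm F_lim).
- exact: (limit_norm_ge0 x_norm F_lim).
- exact: (limit_norm_le_sum x_norm F_lim).
Qed.

End SecondPart.

Theorem theoremC (R : realType) (X : completeNormedModType R)
    (hX : infinite_dimensional X) :
  (exists x : nat -> X,
     basic_sequence x /\ (forall y : nat -> X, nccb x y -> good y)) /\
  (forall x : nat -> X,
     basic_sequence x -> (forall y : nat -> X, nccb x y -> good y) ->
     semi_normalized x -> unconditional x ->
     exists2 C : R, 1 <= C &
       nccb_spreading_models_equivalent x C (@c0_norm R) \/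
       (exists2 p : R, 1 <= p &
          nccb_spreading_models_equivalent x C (lp_norm p))).
Proof.
split; first exact: good_nccb_exists.
by move=> x _; exact: nccb_models_equivalent.
Qed.
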